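(* Let $A\in\mathbb{R}^{d\times d}$ be an invertible matrix with $\rho(A)<1$, and let $P\in\mathbb{R}^{d\times d}$ be a (row-)stochastic matrix with $P_{i,j}>0$ if and only if $A_{i,j}\neq 0$, such that the Markov chain on $[d]=\{1,\dots,d\}$ with transition matrix $P$ is irreducible and aperiodic and such that $\rho(\widehat H)<1$, where $\widehat H_{i,j}=A_{i,j}^2/P_{i,j}$ if $P_{i,j}\ne 0$ and $\widehat H_{i,j}=0$ otherwise. Let $\Gamma^K$ be the $d\times d$ random matrix produced after $K$ iterations of the regenerative Ulam-von Neumann recursion described in the context. Then there exist a $d\times d$ matrix $\Gamma_s$ and a symmetric positive semi-definite $d^2\times d^2$ matrix $M_s$ such that $$\sqrt K\left(\frac{\Gamma^K}{K}-\Gamma_s\right)$$ (viewed as a vector in $\mathbb{R}^{d^2}$) converges in distribution, as $K\to\infty$, to a $d^2$-variate normal variable with mean zero and covariance matrix $M_s$.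
   Context: $\rho(\cdot)$ denotes the spectral radius. Regenerative Ulam-von Neumann recursion. Maintain three $d\times d$ matrices $\Lambda,\Sigma$ (real) and $\Gamma$ (nonnegative integers), all initialized to zero, and a Markov chain on $[d]$ with transition matrix $P$, started at some (random) state $i\in[d]$. One iteration, with current state $i$, does the following in order: (a) for all $k\in[d]$: if $\Lambda_{i,k}=0$, set $\Lambda_{i,k}=1$ (otherwise leave it unchanged); (b) sample the next state $j$ of the chain with probabilities $P_{i,\cdot}$; (c) multiply the whole matrix $\Lambda$ by the scalar $A_{i,j}/P_{i,j}$; (d) for all $k\in[d]$: if $\Lambda_{k,j}\ne0$, increase $\Gamma_{k,j}$ by $1$; (e) for all $k\in[d]$: replace $\Sigma_{k,j}$ by $\Sigma_{k,j}+\Lambda_{k,j}$; (f) for all $k\in[d]$: set $\Lambda_{k,j}=0$; (g) set the current state to $j$. The iteration is repeated; $\Sigma^K,\Gamma^K$ denote the matrices $\Sigma,\Gamma$ after $K$ iterations (Markov transitions). *)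

(* Defs.v *)
From HB Require Import structures.
From mathcomp Require Import all_boot all_order all_algebra.
From mathcomp Require Import complex.
From mathcomp Require Import all_classical all_reals all_analysis.

Set Implicit Arguments.
Unset Strict Implicit.
Unset Printing Implicit Defensive.

Import Order.TTheory GRing.Theory Num.Theory.
Import numFieldNormedType.Exports.

Local Open Scope classical_set_scope.
Local Open Scope ring_scope.

(* The eigenvalues of a real matrix are taken in the complex field [R[i]]. *)
Definition spectral_radius (R : realType) (d : nat) (A : 'M[R]_d) : R :=
  sup [set r : R | exists2 z : R[i],
    eigenvalue (map_mx (real_complex R) A) z & r = ComplexField.Normc.normc z].

Definition stochastic (R : realType) (d : nat) (P : 'M[R]_d) : Prop :=
  (forall i j, 0 <= P i j) /\ (forall i, \sum_j P i j = 1).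

Definition irreducible (R : realType) (d : nat) (P : 'M[R]_d) : Prop :=
  forall i j, exists n : nat, 0 < (P ^+ n) i j.

(* The period gcd {n >= 1 | (P^n)_ii > 0} is 1 at every state: a common divisor
   of the return times can only be 1 (this fails when there are none). *)
Definition aperiodic (R : realType) (d : nat) (P : 'M[R]_d) : Prop :=
  forall (i : 'I_d) (g : nat),
    (forall n : nat, (0 < n)%N -> 0 < (P ^+ n) i i -> (g %| n)%N) -> g = 1%N.

Definition Hhat (R : realType) (d : nat) (A P : 'M[R]_d) : 'M[R]_d :=
  \matrix_(i, j) (if P i j != 0 then A i j ^+ 2 / P i j else 0).

(* Measurability, and the Markov property conditionally on the whole past with
   the conditional probability multiplied out; the law of [X 0] is free. *)
Definition markov_chain (R : realType) (disp : measure_display)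
    (T : measurableType disp) (Pr : probability T R) (d : nat) (P : 'M[R]_d)
    (X : nat -> T -> 'I_d) : Prop :=
  (forall n i, measurable [set w | X n w = i]) /\
  (forall (n : nat) (s : nat -> 'I_d),
    Pr [set w | forall k, (k <= n.+1)%N -> X k w = s k] =
    (Pr [set w | forall k, (k <= n)%N -> X k w = s k]
       * (P (s n) (s n.+1))%:E)%E).

Record uvn_state (R : realType) (d : nat) := UvnState {
  uvn_Lambda : 'M[R]_d;
  uvn_Sigma : 'M[R]_d;
  uvn_Gamma : 'M[nat]_d }.

Definition uvn_init (R : realType) (d : nat) : uvn_state R d :=
  UvnState (const_mx 0) (const_mx 0) (const_mx 0%N).

Definition uvn_step (R : realType) (d : nat) (A P : 'M[R]_d) (i j : 'I_d)
    (st : uvn_state R d) : uvn_state R d :=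
  let L := uvn_Lambda st in
  let La : 'M[R]_d := \matrix_(k, l)
    (if (k == i) && (L k l == 0) then 1 else L k l) in
  let Lc : 'M[R]_d := (A i j / P i j) *: La in
  let G : 'M[nat]_d := \matrix_(k, l)
    (if (l == j) && (Lc k l != 0) then (uvn_Gamma st k l).+1
     else uvn_Gamma st k l) in
  let S : 'M[R]_d := \matrix_(k, l)
    (if l == j then uvn_Sigma st k l + Lc k l else uvn_Sigma st k l) in
  let Lf : 'M[R]_d := \matrix_(k, l) (if l == j then 0 else Lc k l) in
  UvnState Lf S G.

(* The state after [K] iterations along the trajectory [x 0, x 1, ...]. *)
Fixpoint uvn_run (R : realType) (d : nat) (A P : 'M[R]_d) (x : nat -> 'I_d)
    (K : nat) : uvn_state R d :=
  if K is K'.+1 then uvn_step A P (x K') (x K'.+1) (uvn_run A P x K')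
  else uvn_init R d.

Definition GammaK (R : realType) (d : nat) (A P : 'M[R]_d) (x : nat -> 'I_d)
    (K : nat) : 'M[R]_d :=
  map_mx (fun n : nat => n%:R) (uvn_Gamma (uvn_run A P x K)).

Definition symmetric_psd (R : realType) (n : nat) (M : 'M[R]_n) : Prop :=
  M^T = M /\ (forall v : 'rV[R]_n, 0 <= (v *m M *m v^T) 0 0).

Definition random_vector (R : realType) (disp : measure_display)
    (T : measurableType disp) (n : nat) (Y : T -> 'rV[R]_n) : Prop :=
  forall i, measurable_fun [set: T] (fun w => Y w 0 i).

(* The normal law on the line with mean [m] and standard deviation [s]. The
   library's [normal_prob m 0] is the uniform law on [0, 1], so the degenerate
   case [s = 0], the point mass at [m], is treated apart. *)
Definition normal_law (R : realType) (m s : R) (B : set R) : \bar R :=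
  if s == 0 then \d_m B else normal_prob m s B.

(* A possibly degenerate Gaussian vector: each linear combination of the
   coordinates has a normal law. *)
Definition gaussian_vector (R : realType) (disp : measure_display)
    (T : measurableType disp) (Q : probability T R) (n : nat)
    (Y : T -> 'rV[R]_n) : Prop :=
  random_vector Y /\
  (forall u : 'rV[R]_n, exists m s : R, 0 <= s /\
    (forall B : set R, measurable B ->
      Q [set w | B (\sum_i u 0 i * Y w 0 i)] = normal_law m s B)).

Definition multivariate_normal (R : realType) (disp : measure_display)
    (T : measurableType disp) (Q : probability T R) (n : nat)
    (Y : T -> 'rV[R]_n) (mean : 'rV[R]_n) (cov : 'M[R]_n) : Prop :=
  [/\ gaussian_vector Q Y,
      forall i, 'E_Q[fun w => Y w 0%R i]%E = (mean 0 i)%:E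
    & forall i j,
        covariance Q (fun w => Y w 0 i) (fun w => Y w 0 j) = (cov i j)%:E].

Definition cvg_in_distribution (R : realType) (n : nat)
    (disp : measure_display) (T : measurableType disp) (Pr : probability T R)
    (Z : nat -> T -> 'rV[R]_n)
    (disp' : measure_display) (T' : measurableType disp') (Q : probability T' R)
    (Y : T' -> 'rV[R]_n) : Prop :=
  (forall K, random_vector (Z K)) /\
  (forall f : 'rV[R]_n -> R,
    continuous f -> (exists C : R, forall x, `|f x| <= C) ->
    'E_Pr[fun w => f (Z K w)]%E @[K --> \oo] --> 'E_Q[fun w => f (Y w)]%E).

(* Main.v *)
(* The matrix Gamma^K counts the steps at which the entries of Lambda are alive,
   and the pattern of nonzero entries of Lambda together with the current state
   is a finite Markov chain with a state reachable from everywhere. So Gamma^K is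
   an additive functional of a finite chain. Solving the Poisson equation twice
   (for the drift and for the conditional variance) turns cos (s S + b), up to
   O(s), into an approximate eigenfunction of the transition operator, with
   eigenvalue exp (- sigma^2 s^2 / 2) + O(s^3); taking s = 1 / sqrt K gives the
   convergence of E cos (<u, Z_K> + b) to its Gaussian value. Trigonometric
   polynomials approximate a bounded continuous function on boxes while staying
   bounded by it, and the second moments of Z_K are bounded, so this is enough
   for convergence in distribution. *)

From HB Require Import structures.
Require Import Defs.
From mathcomp Require Import all_boot all_order all_algebra.
From mathcomp Require Import all_classical all_reals all_analysis.
From mathcomp Require Import measurable_realfun ring lra.

Set Implicit Arguments.
Unset Strict Implicit.
Unset Printing Implicit Defensive.

Import Order.TTheory GRing.Theory Num.Theory.
Import numFieldNormedType.Exports.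

Local Open Scope classical_set_scope.
Local Open Scope ring_scope.

(** * The Poisson equation of a finite chain *)

(** Only the status of the entries of Lambda is kept, not their values: entries are set to 0 or 1 or
    scaled, never added to one another, so being nonzero obeys boolean rules. The resulting chain
    may have transient patterns, so the arguments rest on one state [e0] reachable from everywhere
    and on the maximum principle. Transitions carry a label [j], drawn with probability [p e j] and
    leading to [upd e j], because the increment of a count depends on the transition and not on the
    state alone; the label is the next state of the original chain. The limit covariance is produced
    in factored form [B^T *m B], with one row of [B] per labelled transition. Positive
    semi-definiteness and the limiting vector, a linear image of a standard Gaussian one, then come
    together, and degenerate directions need no separate construction. The free phase [b] in the
    cosines makes them span the sines as well, so no complex exponentials occur. *)

Definition markov_op (R : realType) (E J : finType) (p : E -> J -> R)
    (upd : E -> J -> E) (g : E -> R) (e : E) : R :=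
  \sum_j p e j * g (upd e j).

Definition transition_rel (R : realType) (E J : finType) (p : E -> J -> R)
    (upd : E -> J -> E) : rel E :=
  fun e e' => [exists j, (0 < p e j) && (upd e j == e')].

Lemma markov_opN (R : realType) (E J : finType) (p : E -> J -> R) upd
    (g : E -> R) (e : E) :
  markov_op p upd (fun x => - g x) e = - markov_op p upd g e.
Proof. by rewrite /markov_op -sumrN; apply: eq_bigr => j _; rewrite mulrN. Qed.

Lemma le_markov_op (R : realType) (E J : finType) (p : E -> J -> R) upd
    (p0 : forall e j, 0 <= p e j) (p1 : forall e, \sum_j p e j = 1)
    (g : E -> R) (c : R) (e : E) : (forall x, g x <= c) ->
  markov_op p upd g e <= c.
Proof.
move=> gc; rewrite /markov_op -[leRHS]mul1r -(p1 e) mulr_suml.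
by apply: ler_sum => j _; rewrite ler_wpM2l.
Qed.

(** Maximum principle: where a harmonic function is maximal, so is it after every transition of
    positive probability, and such transitions lead to [e0]. States that are never revisited are
    allowed. *)
Lemma harmonic_le (R : realType) (E J : finType) (p : E -> J -> R) upd
    (p0 : forall e j, 0 <= p e j) (p1 : forall e, \sum_j p e j = 1)
    (e0 : E) (reach : forall e, connect (transition_rel p upd) e e0)
    (g : E -> R) :
  (forall e, g e = markov_op p upd g e) -> forall e, g e <= g e0.
Proof.
move=> gh; case: (Order.TotalTheory.arg_maxP g (erefl : xpredT e0)) => em _ gmax0.
have gmax y : g y <= g em by exact: gmax0.
suff -> : g e0 = g em by move=> e; exact: gmax.
clear gmax0.
have step x y : transition_rel p upd x y -> g x = g em -> g y = g em.
  move=> /existsP[j /andP[pj /eqP <-]] gx; apply/eqP.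
  have sum0 : \sum_i p x i * (g em - g (upd x i)) = 0.
    under eq_bigr do rewrite mulrBr.
    by rewrite sumrB -mulr_suml p1 mul1r -[X in _ - X]gh gx subrr.
  have nn i : true -> 0 <= p x i * (g em - g (upd x i)).
    by move=> _; rewrite mulr_ge0 // subr_ge0 gmax.
  have /eqP := psumr_eq0P nn sum0 (isT : xpredT j).
  by rewrite mulf_eq0 gt_eqF //= subr_eq0 eq_sym.
have /connectP[s sp ->] := reach em.
suff run x : path (transition_rel p upd) x s -> g x = g em -> g (last x s) = g em.
  exact: run.
elim: s {sp} x => //= y s IH x /andP[xy sp] gx.
exact: IH sp (step _ _ xy gx).
Qed.

Lemma harmonic_const (R : realType) (E J : finType) (p : E -> J -> R) upd
    (p0 : forall e j, 0 <= p e j) (p1 : forall e, \sum_j p e j = 1)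
    (e0 : E) (reach : forall e, connect (transition_rel p upd) e e0)
    (g : E -> R) :
  (forall e, g e = markov_op p upd g e) -> forall e, g e = g e0.
Proof.
move=> gh e; apply/eqP; rewrite eq_le (harmonic_le p0 p1 reach) //=.
rewrite -lerN2; apply: (harmonic_le p0 p1 reach (g := fun x => - g x)).
by move=> x; rewrite markov_opN -gh.
Qed.

(** At a minimum of [g] the average over the next state is at least [g], so there [v] is at most
    [c]. *)
Lemma ge0_defect (R : realType) (E J : finType) (p : E -> J -> R) upd
    (p0 : forall e j, 0 <= p e j) (p1 : forall e, \sum_j p e j = 1) (e0 : E)
    (g v : E -> R) (c : R) : (forall e, v e = g e - markov_op p upd g e + c) ->
  (forall e, 0 <= v e) -> 0 <= c.
Proof.
move=> vE v0; case: (Order.TotalTheory.arg_maxP (fun x => - g x) (erefl : xpredT e0)) => em _ gmax.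
have gmaxe y : - g y <= - g em by exact: gmax.
have := le_markov_op upd p0 p1 em gmaxe.
rewrite markov_opN => gle; have := v0 em; rewrite vE; lra.
Qed.

(* The map g |-> g - P g + g e0 is injective by the maximum principle, hence
   bijective; [w] is the functional v |-> g e0 of its inverse. *)
Lemma poisson_equation (R : realType) (E J : finType) (p : E -> J -> R) upd
    (p0 : forall e j, 0 <= p e j) (p1 : forall e, \sum_j p e j = 1)
    (e0 : E) (reach : forall e, connect (transition_rel p upd) e e0) :
  exists w : E -> R, (forall e, 0 <= w e) /\
    forall v : E -> R, exists g : E -> R, forall e,
      v e = g e - markov_op p upd g e + \sum_x w x * v x.
Proof.
pose F (g : {ffun E -> R^o}) : {ffun E -> R^o} :=
  [ffun e => g e - markov_op p upd g e + g e0].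
have Flin : linear F.
  move=> a u v; apply/ffunP => e; rewrite !ffunE /markov_op.
  under eq_bigr do rewrite !ffunE mulrDr mulrCA.
  rewrite big_split /= -mulr_sumr /GRing.scale /=; ring.
pose FL : {linear {ffun E -> R^o} -> {ffun E -> R^o}} :=
  HB.pack F (GRing.isLinear.Build _ _ _ _ F Flin).
have ker0 : lker (linfun FL) == 0%VS.
  apply/lker0P => u v; rewrite !lfunE /= => uv.
  apply/eqP; rewrite -subr_eq0; apply/eqP; set g := u - v.
  have Fg e : 0 = g e - markov_op p upd g e + g e0.
    have : F g = 0 by rewrite -[F]/(FL : _ -> _) raddfB /= uv subrr.
    by move/ffunP/(_ e); rewrite !ffunE.
  (* [Fg] presents 0 as the defect of [g] plus [g e0]; [ge0_defect] for [g] and for [- g] gives the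
     two signs. *)
  have c0 : g e0 = 0.
    apply/eqP; rewrite eq_le (ge0_defect p0 p1 e0 Fg) ?andbT//.
    rewrite -oppr_ge0.
    apply: (@ge0_defect _ _ _ p upd p0 p1 e0 (fun x => - g x) (fun=> 0)) => // e.
    by rewrite markov_opN; have := Fg e; lra.
  apply/ffunP => e; rewrite [RHS]ffunE -[RHS]c0.
  apply: (harmonic_const p0 p1 reach) => x.
  by apply/esym/eqP; rewrite -subr_eq0 -oppr_eq0 opprB; have := Fg x; rewrite c0 addr0 => <-.
pose G v := ((linfun FL)^-1)%VF v.
have FG v : F (G v) = v.
  by rewrite -[F _]/(FL (G v)) -[FL _]lfunE; exact: (lker0_lfunVK ker0).
(* These weights form the invariant law: the functional takes [f - P f] to 0 and the constant 1 to
   1. Nonnegativity comes from [ge0_defect] applied to indicators. *)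
pose w e := (G [ffun x => (x == e)%:R : R^o]) e0 : R.
have wE (v : {ffun E -> R^o}) : G v e0 = \sum_x w x * v x.
  have {1}-> : v = \sum_x v x *: ([ffun y => (y == x)%:R] : {ffun E -> R^o}).
    apply/ffunP => e; rewrite sum_ffunE (bigD1 e) //= big1 ?addr0 => [|i ie].
      by rewrite !ffunE eqxx /GRing.scale /= mulr1.
    by rewrite !ffunE eq_sym (negPf ie) scaler0.
  rewrite /G linear_sum sum_ffunE; apply: eq_bigr => i _.
  by rewrite linearZ ffunE /GRing.scale /= mulrC.
have repr (v : {ffun E -> R^o}) e : v e = G v e - markov_op p upd (G v) e + G v e0.
  by rewrite -{1}(FG v) ffunE.
exists w; split.
  move=> e; apply: (ge0_defect p0 p1 e0 (repr _)) => x.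
  by rewrite ffunE; case: (_ == _).
move=> v; exists (G [ffun x => v x]) => e.
have := repr [ffun x => v x] e; rewrite ffunE => {1}->; rewrite wE.
by congr (_ + _); apply: eq_bigr => x _; rewrite ffunE.
Qed.

(** * Taylor estimates for the cosine *)

Lemma normM_le (R : realType) (a b A B : R) :
  `|a| <= A -> `|b| <= B -> `|a * b| <= A * B.
Proof. by move=> aA bB; rewrite normrM ler_pM. Qed.

Lemma norm_sin_le (R : realType) (x : R) : `|sin x| <= `|x|.
Proof.
wlog x0 : x / 0 <= x => [wlg|].
  have [/wlg//|x0] := leP 0 x; rewrite -normrN -sinN -[leRHS]normrN.
  by apply: wlg; rewrite oppr_ge0 ltW.
move: x0; rewrite le_eqVlt => /orP[/eqP <-|x0]; first by rewrite sin0.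
have [|c _] := @MVT R sin cos 0 x x0 (fun c _ => is_derive_sin c).
  by apply: continuous_subspaceT => c; exact: continuous_sin.
rewrite sin0 !subr0 => ->; rewrite normrM ler_piMl //.
by rewrite ler_norml cos_geN1 cos_le1.
Qed.

Lemma norm_cos_le1 (R : realType) (x : R) : `|cos x| <= 1.
Proof. by rewrite ler_norml cos_geN1 cos_le1. Qed.

Lemma norm_sin_le1 (R : realType) (x : R) : `|sin x| <= 1.
Proof. by rewrite ler_norml sin_geN1 sin_le1. Qed.

Lemma cos_half (R : realType) (x : R) : 1 - cos x = sin (x / 2) ^+ 2 *+ 2.
Proof.
have {1}-> : x = x / 2 *+ 2 by rewrite -mulr_natr divfK.
rewrite cos_mulr2n; have := cos2Dsin2 (x / 2); set a := cos _ ; set b := sin _; lra.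
Qed.

Lemma sqr_sin_half_le (R : realType) (x : R) : sin (x / 2) ^+ 2 <= x ^+ 2 / 4.
Proof.
rewrite -(real_normK (num_real (sin _))).
have -> : x ^+ 2 / 4 = `|x / 2| ^+ 2 by rewrite real_normK ?num_real // expr_div_n; lra.
by rewrite ler_sqr ?nnegrE //; exact: norm_sin_le.
Qed.

Lemma one_sub_cos_le (R : realType) (x : R) : 1 - cos x <= x ^+ 2 / 2.
Proof. by rewrite cos_half; have := sqr_sin_half_le x; lra. Qed.

(** The mean value theorem multiplies the bound on the derivative by the length of the interval
    instead of integrating it; hence 1/2 where Taylor has 1/6. Only the orders matter later. *)
Lemma norm_sub_sin_le (R : realType) (x : R) : `|x - sin x| <= `|x| ^+ 3 / 2.
Proof.
wlog x0 : x / 0 <= x => [wlg|].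
  have [/wlg//|x0] := leP 0 x.
  rewrite -normrN opprB addrC -[sin x]opprK -sinN -(normrN x).
  by apply: wlg; rewrite oppr_ge0 ltW.
move: x0; rewrite le_eqVlt => /orP[/eqP <-|x0].
  by rewrite sin0 subrr normr0 expr0n mul0r.
have [|c] := @MVT R (fun y => y - sin y) (fun y => 1 - cos y) 0 x x0.
  apply: continuous_subspaceT => c; apply: continuousB; first exact: cvg_id.
  exact: continuous_sin.
rewrite in_itv /= => /andP[c0 cx]; rewrite sin0 !subr0 => ->.
rewrite normrM !(gtr0_norm x0) ger0_norm ?subr_ge0 ?cos_le1 //.
have := one_sub_cos_le c; have : c ^+ 2 <= x ^+ 2 by rewrite ler_sqr ?nnegrE ltW.
rewrite [x ^+ 3]exprSr; set u := c ^+ 2; set v := x ^+ 2 => uv cu.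
have -> : v * x / 2 = v / 2 * x by lra.
by rewrite ler_pM2r //; lra.
Qed.

Lemma norm_cos_taylor0 (R : realType) (x : R) :
  `|cos x - 1 + x ^+ 2 / 2| <= x ^+ 4 / 2.
Proof.
wlog x0 : x / 0 <= x => [wlg|].
  have [/wlg//|x0] := leP 0 x.
  have e4 : (- x) ^+ 4 = x ^+ 4 by ring.
  have := wlg (- x); rewrite cosN sqrrN e4.
  by apply; rewrite oppr_ge0 ltW.
move: x0; rewrite le_eqVlt => /orP[/eqP <-|x0].
  by rewrite cos0 subrr !expr0n /= mul0r addr0 normr0.
have [||c] := @MVT R (fun y => cos y - 1 + y ^+ 2 / 2) (fun y => y - sin y) 0 x x0.
- move=> c _; apply: is_derive_eq.
  by rewrite /GRing.scale /=; lra.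
- apply: continuous_subspaceT => c.
  apply: differentiable_continuous; apply/derivable1_diffP; exact: ex_derive.
rewrite in_itv /= => /andP[c0 cx]; rewrite cos0 expr0n /= mul0r !subr0 subrr addr0 subr0 => ->.
rewrite normrM !(gtr0_norm x0).
have := norm_sub_sin_le c; rewrite (gtr0_norm c0).
have : c ^+ 3 <= x ^+ 3 by apply: lerXn2r; rewrite ?nnegrE ltW.
rewrite [x ^+ 4]exprSr; set u := c ^+ 3; set v := x ^+ 3 => uv cu.
have -> : v * x / 2 = v / 2 * x by lra.
by rewrite ler_pM2r //; lra.
Qed.

Lemma norm_cos_taylor2 (R : realType) (y x : R) :
  `|cos (y + x) - (cos y - x * sin y - x ^+ 2 / 2 * cos y)|
  <= (x ^+ 4 + `|x| ^+ 3) / 2.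
Proof.
rewrite cosD.
have -> : cos y * cos x - sin y * sin x - (cos y - x * sin y - x ^+ 2 / 2 * cos y) =
  cos y * (cos x - 1 + x ^+ 2 / 2) + sin y * (x - sin x) by lra.
apply: (le_trans (ler_normD _ _)); rewrite !normrM mulrDl lerD //.
  apply: le_trans (norm_cos_taylor0 x); by rewrite ler_piMl ?norm_cos_le1.
by apply: le_trans (norm_sub_sin_le x); rewrite ler_piMl ?norm_sin_le1.
Qed.

Lemma norm_cos_taylor1 (R : realType) (y x : R) :
  `|cos (y + x) - cos y + x * sin y| <= 3 * x ^+ 2.
Proof.
rewrite cosD.
have -> : cos y * cos x - sin y * sin x - cos y + x * sin y =
  - (cos y * (1 - cos x)) + sin y * (x - sin x) by ring.
have x2 := sqr_ge0 x.
have h1 : `|cos y * (1 - cos x)| <= 1 * (x ^+ 2 / 2).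
  apply: normM_le; first exact: norm_cos_le1.
  by rewrite ger0_norm ?subr_ge0 ?cos_le1 // one_sub_cos_le.
have h2 : `|sin y * (x - sin x)| <= 1 * (2 * x ^+ 2).
  apply: normM_le; first exact: norm_sin_le1.
  (* The cubic bound lies below a square only for [|x| <= 1]; beyond, [|x| + |sin x| <= 2 |x|] is
     enough. *)
  rewrite -(real_normK (num_real x)); have [x1|x1] := leP `|x| 1.
    apply: le_trans (norm_sub_sin_le _) _; have x0 := normr_ge0 x.
    have : `|x| ^+ 3 <= `|x| ^+ 2 by rewrite exprS ler_piMl ?sqr_ge0.
    by have := sqr_ge0 `|x|; lra.
  apply: le_trans (ler_normB _ _) _; have := norm_sin_le x.
  have : `|x| <= `|x| ^+ 2 by rewrite expr2 ler_peMl ?normr_ge0 // ltW.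
  lra.
apply: (le_trans (ler_normD _ _)); rewrite normrN; lra.
Qed.

Lemma cos_lipschitz (R : realType) (x y : R) : `|cos x - cos y| <= `|x - y|.
Proof.
wlog xy : x y / x <= y => [wlg|].
  have [/wlg//|yx] := leP x y; rewrite distrC [leRHS]distrC; exact/wlg/ltW.
move: xy; rewrite le_eqVlt => /orP[/eqP <-|xy]; first by rewrite !subrr.
have [|c _] := @MVT R cos (fun z => - sin z) x y xy (fun c _ => is_derive_cos c).
  by apply: continuous_subspaceT => c; exact: continuous_cos.
rewrite distrC => ->; rewrite normrM normrN distrC ler_piMl //.
exact: norm_sin_le1.
Qed.

(** From [expR y >= 1 + y] follows [expR (- y) <= 1 / (1 + y) <= 1 - y + y^2]. *)
Lemma expRN_taylor1 (R : realType) (y : R) : 0 <= y ->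
  `|expR (- y) - (1 - y)| <= y ^+ 2.
Proof.
move=> y0; have := expR_ge1Dx (- y); have := expR_ge1Dx y.
have e0 := expR_gt0 y; have e0' := expR_gt0 (- y).
have := expRxMexpNx_1 y; set a := expR y in e0 *; set b := expR (- y) in e0' *.
move=> ab ay bly; rewrite ger0_norm; last lra.
have : b * (1 + y) <= 1 by rewrite -ab mulrC; apply: ler_pM => //; lra.
move=> h; nra.
Qed.

(** * Additive functionals of a finite chain *)

(** Transition operator of the pair (state, accumulated sum); its [K]-th iterate at [(e, 0)] is the
    expectation of [G] after [K] steps from [e]. The sum lives in a general [V], as the operator
    serves both real functionals and a walk in space. *)
Definition walk_op (R : realType) (E J : finType) (V : zmodType) (p : E -> J -> R)
    (upd : E -> J -> E) (z : E -> J -> V) (G : E -> V -> R) (e : E) (v : V) : R :=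
  \sum_j p e j * G (upd e j) (v + z e j).

Lemma walk_op_close (R : realType) (E J : finType) (V : zmodType) (p : E -> J -> R)
    (upd : E -> J -> E) (z : E -> J -> V)
    (p0 : forall e j, 0 <= p e j) (p1 : forall e, \sum_j p e j = 1)
    (G H : E -> V -> R) (c : R) : (forall e v, `|G e v - H e v| <= c) ->
  forall K e v, `|iter K (walk_op p upd z) G e v - iter K (walk_op p upd z) H e v| <= c.
Proof.
move=> GH; elim=> [//|K IH] e v; rewrite !iterS /walk_op -sumrB.
rewrite -[leRHS]mul1r -(p1 e) mulr_suml.
apply: le_trans (ler_norm_sum _ _ _) _; apply: ler_sum => j _.
by rewrite -mulrBr normrM (ger0_norm (p0 _ _)) ler_wpM2l.
Qed.

Lemma walk_op_le (R : realType) (E J : finType) (V : zmodType) (p : E -> J -> R)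
    (upd : E -> J -> E) (z : E -> J -> V)
    (p0 : forall e j, 0 <= p e j)
    (G H : E -> V -> R) : (forall e v, G e v <= H e v) ->
  forall K e v, iter K (walk_op p upd z) G e v <= iter K (walk_op p upd z) H e v.
Proof.
move=> GH; elim=> [//|K IH] e v; rewrite !iterS /walk_op.
by apply: ler_sum => j _; rewrite ler_wpM2l.
Qed.

Lemma walk_op_affine (R : realType) (E J : finType) (V : zmodType) (p : E -> J -> R)
    (upd : E -> J -> E) (z : E -> J -> V)
    (p1 : forall e, \sum_j p e j = 1) (G : E -> V -> R) (a c : R) e v :
  walk_op p upd z (fun e v => a * G e v + c) e v = a * walk_op p upd z G e v + c.
Proof.
rewrite /walk_op mulr_sumr -[X in _ = _ + X]mul1r -(p1 e) mulr_suml -big_split /=.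
by apply: eq_bigr => j _; rewrite mulrDr mulrCA.
Qed.

(** The errors telescope: each step adds at most [c], since the operator contracts the sup norm and
    powers of [a] stay below 1. *)
Lemma walk_op_near_eigen (R : realType) (E J : finType) (V : zmodType) (p : E -> J -> R)
    (upd : E -> J -> E) (z : E -> J -> V)
    (p0 : forall e j, 0 <= p e j) (p1 : forall e, \sum_j p e j = 1)
    (G : E -> V -> R) (a c : R) : 0 <= a <= 1 ->
  (forall e v, `|walk_op p upd z G e v - a * G e v| <= c) ->
  forall K e v, `|iter K (walk_op p upd z) G e v - a ^+ K * G e v| <= K%:R * c.
Proof.
move=> /andP[a0 a1] Gc; elim=> [|K IH] e v.
  by rewrite expr0 mul1r subrr normr0 mul0r.
have -> : iter K.+1 (walk_op p upd z) G e v - a ^+ K.+1 * G e v =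
  (iter K.+1 (walk_op p upd z) G e v - walk_op p upd z (fun e v => a ^+ K * G e v + 0) e v)
  + a ^+ K * (walk_op p upd z G e v - a * G e v).
  by rewrite walk_op_affine // exprSr; ring.
rewrite -natr1 mulrDl mul1r; apply: le_trans (ler_normD _ _) _; apply: lerD.
  apply: (@walk_op_close _ _ _ _ p upd z p0 p1 (iter K (walk_op p upd z) G)
    (fun e v => a ^+ K * G e v + 0) _ _ 1) => e' v'.
  by rewrite addr0.
rewrite normrM; apply: le_trans (Gc e v).
by rewrite ler_piMl // normrX exprn_ile1 // ger0_norm.
Qed.

Lemma bounded_finfun (R : realType) (E : finType) (f : E -> R) :
  exists2 M : R, 1 <= M & forall e, `|f e| <= M.
Proof.
exists (1 + \sum_e `|f e|); first by rewrite lerDl sumr_ge0.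
move=> e; rewrite (bigD1 e) //= addrCA lerDl addr_ge0 // sumr_ge0 //.
Qed.

(** Here [y] is the present phase, [x] the martingale increment and [g] the variance corrector at
    the new state. The three summands of the constant bound the Taylor remainder times the
    correcting factor and the two cross terms of orders [s^3] and [s^4]. *)
Lemma corrected_cos_term (R : realType) (M s y x g : R) :
  1 <= M -> 0 < s <= 1 -> `|x| <= M -> `|g| <= M ->
  `|cos (y + s * x) * (1 - s ^+ 2 / 2 * g) -
    (cos y - s * x * sin y - s ^+ 2 * x ^+ 2 / 2 * cos y - s ^+ 2 / 2 * g * cos y)|
  <= s ^+ 3 * (M ^+ 4 * (1 + M) + M ^+ 2 + M ^+ 3).
Proof.
move=> M1 /andP[s0 s1] xM gM.
have M0 : 0 <= M by lra.
have s0' := ltW s0.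
set r := cos (y + s * x) - (cos y - s * x * sin y - (s * x) ^+ 2 / 2 * cos y).
have rle : `|r| <= s ^+ 3 * M ^+ 4.
  apply: le_trans (norm_cos_taylor2 _ _) _.
  rewrite -[(s * x) ^+ 4]ger0_norm ?exprn_even_ge0 // normrX.
  have := normr_ge0 (s * x); have : `|s * x| <= s * M by rewrite normrM ger0_norm // ler_wpM2l.
  set t := `|s * x| => tM t0.
  have t3 : t ^+ 3 <= (s * M) ^+ 3 by apply: lerXn2r; rewrite ?nnegrE // mulr_ge0.
  have t4 : t ^+ 4 <= (s * M) ^+ 4 by apply: lerXn2r; rewrite ?nnegrE // mulr_ge0.
  have e3 : (s * M) ^+ 3 <= s ^+ 3 * M ^+ 4.
    by rewrite exprMn [M ^+ 4]exprS ler_wpM2l ?exprn_ge0 // ler_peMl // exprn_ge0.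
  have e4 : (s * M) ^+ 4 <= s ^+ 3 * M ^+ 4.
    by rewrite exprMn ler_wpM2r ?exprn_ge0 // [s ^+ 4]exprS ler_piMl // exprn_ge0.
  lra.
have g1 : `|1 - s ^+ 2 / 2 * g| <= 1 + M.
  apply: le_trans (ler_normB _ _) _; rewrite normr1 lerD2l.
  rewrite -[leRHS]mul1r; apply: normM_le => //.
  rewrite ger0_norm ?divr_ge0 ?exprn_ge0 //.
  by have : s ^+ 2 <= 1 by [rewrite exprn_ile1]; lra.
have xg : `|s ^+ 3 / 2 * (x * (g * sin y))| <= s ^+ 3 * M ^+ 2.
  apply: normM_le.
    by have := exprn_ge0 3 s0' => h; rewrite ger0_norm; lra.
  apply: normM_le => //; rewrite -[leRHS]mulr1; apply: normM_le => //.
  exact: norm_sin_le1.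
have xxg : `|s ^+ 3 * (s / 4 * (x * (x * (g * cos y))))| <= s ^+ 3 * M ^+ 3.
  apply: normM_le; first by rewrite ger0_norm ?exprn_ge0.
  rewrite -[leRHS]mul1r; apply: normM_le; first by rewrite ger0_norm; lra.
  rewrite !exprS expr0; do 2!apply: normM_le => //; apply: normM_le => //.
  exact: norm_cos_le1.
have -> : cos (y + s * x) * (1 - s ^+ 2 / 2 * g) -
    (cos y - s * x * sin y - s ^+ 2 * x ^+ 2 / 2 * cos y - s ^+ 2 / 2 * g * cos y)
  = r * (1 - s ^+ 2 / 2 * g) + s ^+ 3 / 2 * (x * (g * sin y)) +
    s ^+ 3 * (s / 4 * (x * (x * (g * cos y)))).
  rewrite /r; lra.
rewrite [leRHS]mulrDr [s ^+ 3 * (_ + M ^+ 2)]mulrDr.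
apply: le_trans (ler_normD _ _) _; apply: lerD => //.
apply: le_trans (ler_normD _ _) _; apply: lerD => //.
by rewrite [leRHS]mulrA; exact: normM_le.
Qed.

(* [h] is the Poisson corrector turning the sum of [z] into a martingale with
   increments D, [g] the corrector of the conditional variance of D. *)
Lemma walk_op_cos_cvg (R : realType) (E J : finType) (p : E -> J -> R)
    (upd : E -> J -> E) (z : E -> J -> R)
    (p0 : forall e j, 0 <= p e j) (p1 : forall e, \sum_j p e j = 1)
    (h g : E -> R) (sig2 : R)
    (D := fun e j => z e j + h (upd e j) - h e)
    (D0 : forall e, \sum_j p e j * D e j = 0)
    (sig2_ge0 : 0 <= sig2)
    (gE : forall e, \sum_j p e j * D e j ^+ 2 - sig2 = g e - markov_op p upd g e) :
  exists C : R, forall (K : nat) (b : R) (e : E), (0 < K)%N ->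
    `|iter K (walk_op p upd z) (fun _ v => cos ((Num.sqrt K%:R)^-1 * v + b)) e 0
      - expR (- (sig2 / 2)) * cos b| <= C * (Num.sqrt K%:R)^-1.
Proof.
have [Mh Mh1 hM] := bounded_finfun h.
have [Mg Mg1 gM] := bounded_finfun g.
have [MD MD1 DM] := bounded_finfun (fun x : E * J => D x.1 x.2).
pose M := Mh + Mg + MD.
have M1 : 1 <= M by rewrite /M; lra.
have {}hM e : `|h e| <= M by apply: le_trans (hM e) _; rewrite /M; lra.
have {}gM e : `|g e| <= M by apply: le_trans (gM e) _; rewrite /M; lra.
have {}DM e j : `|D e j| <= M by apply: le_trans (DM (e, j)) _; rewrite /M; lra.
pose C0 := M ^+ 4 * (1 + M) + M ^+ 2 + M ^+ 3.
(* [C1] bounds the error of one step in units of [s^3]; since [K s^2 = 1], it accumulates to [C1 s].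
   The extra [4 * M] pays for exchanging the plain cosine and [G] at both ends, [2 * M] each. *)
pose C1 := C0 + sig2 ^+ 2 * (1 + M) + sig2 * M.
exists (C1 + 4 * M) => K b e K0; set s := (Num.sqrt K%:R)^-1.
have sK : 0 < Num.sqrt K%:R :> R by rewrite sqrtr_gt0 ltr0n.
have s0 : 0 < s by rewrite invr_gt0.
have s1 : s <= 1.
  by rewrite invf_le1 // -[leLHS]sqrtr1 ler_sqrt // ler1n.
have s01 : 0 < s <= 1 by rewrite s0.
have Ks2 : K%:R * s ^+ 2 = 1.
  by rewrite exprVn sqr_sqrtr ?ler0n // divff // pnatr_eq0 -lt0n.
(* [v + h e] is a martingale along the walk, which removes the term of order [s]; the factor with
   [g] turns the state-dependent conditional variance into the constant [sig2] at order [s^2]. *)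
pose G e v := cos (s * (v + h e) + b) * (1 - s ^+ 2 / 2 * g e).
pose a := expR (- (sig2 * s ^+ 2 / 2)).
have a01 : 0 <= a <= 1.
  rewrite expR_ge0 /= expR_le1 oppr_le0; apply: divr_ge0 => //.
  by apply: mulr_ge0 => //; exact: sqr_ge0.
have s2 : s ^+ 2 <= 1 by rewrite exprn_ile1 // ltW.
have s30 : 0 <= s ^+ 3 by rewrite exprn_ge0 // ltW.
have s43 : s ^+ 4 <= s ^+ 3 by rewrite [s ^+ 4]exprS ler_piMl.
have s40 : 0 <= s ^+ 4 by rewrite exprn_ge0 // ltW.
have g1 x : `|1 - s ^+ 2 / 2 * g x| <= 1 + M.
  apply: le_trans (ler_normB _ _) _; rewrite normr1 lerD2l.
  rewrite -[leRHS]mul1r; apply: normM_le => //.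
  by have h2 := sqr_ge0 s; rewrite ger0_norm; lra.
have step x v : `|walk_op p upd z G x v - a * G x v| <= s ^+ 3 * C1.
  set y := s * (v + h x) + b.
  (* After the Poisson equation for [g], what is left besides Taylor remainders is
     [1 - sig2 s^2 / 2 - a] times a bounded factor and one product of second-order terms; both are
     of order [s^4]. *)
  have -> : walk_op p upd z G x v - a * G x v =
    \sum_j p x j * (cos (y + s * D x j) * (1 - s ^+ 2 / 2 * g (upd x j)) -
       (cos y - s * D x j * sin y - s ^+ 2 * D x j ^+ 2 / 2 * cos y
          - s ^+ 2 / 2 * g (upd x j) * cos y))
    + cos y * ((1 - sig2 * s ^+ 2 / 2 - a) * (1 - s ^+ 2 / 2 * g x) -
        s ^+ 4 / 4 * (sig2 * g x)).
    have -> : \sum_j p x j * (cos (y + s * D x j) * (1 - s ^+ 2 / 2 * g (upd x j)) -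
       (cos y - s * D x j * sin y - s ^+ 2 * D x j ^+ 2 / 2 * cos y
          - s ^+ 2 / 2 * g (upd x j) * cos y)) =
      walk_op p upd z G x v - cos y * \sum_j p x j + s * sin y * \sum_j p x j * D x j
      + s ^+ 2 / 2 * cos y * \sum_j p x j * D x j ^+ 2
      + s ^+ 2 / 2 * cos y * markov_op p upd g x.
      rewrite /walk_op /markov_op !mulr_sumr -sumrB -!big_split /=.
      apply: eq_bigr => j _; rewrite /G.
      have -> : s * (v + z x j + h (upd x j)) + b = y + s * D x j by rewrite /y /D; ring.
      by ring.
    have -> : \sum_j p x j * D x j ^+ 2 = sig2 + g x - markov_op p upd g x.
      by have := gE x; lra.
    rewrite D0 p1 /G -/y; lra.
  have -> : s ^+ 3 * C1 = s ^+ 3 * C0 +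
      1 * (s ^+ 3 * sig2 ^+ 2 * (1 + M) + s ^+ 3 * (sig2 * M)).
    by rewrite /C1; ring.
  apply: le_trans (ler_normD _ _) _; apply: lerD.
    rewrite -[leRHS]mul1r -[X in X * (s ^+ 3 * C0)](p1 x) mulr_suml.
    apply: le_trans (ler_norm_sum _ _ _) _; apply: ler_sum => j _.
    rewrite normrM (ger0_norm (p0 _ _)) ler_wpM2l //.
    exact: corrected_cos_term.
  apply: normM_le; first exact: norm_cos_le1.
  apply: le_trans (ler_normB _ _) _; apply: lerD.
    apply: normM_le => //.
    rewrite distrC; apply: le_trans (expRN_taylor1 _) _.
      by apply: divr_ge0 => //; apply: mulr_ge0 => //; exact: sqr_ge0.
    have -> : (sig2 * s ^+ 2 / 2) ^+ 2 = s ^+ 4 * sig2 ^+ 2 / 4 by field.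
    have : s ^+ 4 * sig2 ^+ 2 <= s ^+ 3 * sig2 ^+ 2 by rewrite ler_wpM2r ?sqr_ge0.
    have : 0 <= s ^+ 4 * sig2 ^+ 2 by rewrite mulr_ge0 ?sqr_ge0.
    lra.
  apply: normM_le; first by rewrite ger0_norm; lra.
  by apply: normM_le => //; rewrite ger0_norm.
have Gcos x v : `|cos (s * v + b) - G x v| <= s * (2 * M).
  have -> : cos (s * v + b) - G x v = (cos (s * v + b) - cos (s * (v + h x) + b))
    + cos (s * (v + h x) + b) * (s * (s / 2 * g x)) by rewrite /G; ring.
  have -> : s * (2 * M) = s * M + 1 * (s * (1 * M)) by ring.
  apply: le_trans (ler_normD _ _) _; apply: lerD.
    apply: le_trans (cos_lipschitz _ _) _.
    have -> : s * v + b - (s * (v + h x) + b) = s * - h x by ring.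
    by apply: normM_le; rewrite ?normrN // ger0_norm // ltW.
  apply: normM_le; first exact: norm_cos_le1.
  apply: normM_le; first by rewrite ger0_norm // ltW.
  by apply: normM_le => //; rewrite ger0_norm; lra.
have aK : a ^+ K = expR (- (sig2 / 2)).
  rewrite /a -expRM_natl; congr expR.
  by transitivity (- (sig2 * (K%:R * s ^+ 2) / 2)); [ring | rewrite Ks2 mulr1].
set W := iter K _ _ e 0.
have t1 : `|W - iter K (walk_op p upd z) G e 0| <= s * (2 * M).
  exact: (walk_op_close upd z p0 p1 Gcos).
have t2 := walk_op_near_eigen p0 p1 a01 step K e 0.
have t3 : `|a ^+ K * (cos (s * 0 + b) - G e 0)| <= 1 * (s * (2 * M)).
  apply: normM_le => //; case/andP: a01 => a0 a1.
  by rewrite ger0_norm ?exprn_ge0 // exprn_ile1.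
have KC : K%:R * (s ^+ 3 * C1) = s * C1.
  by transitivity (K%:R * s ^+ 2 * s * C1); [ring | rewrite Ks2 mul1r].
rewrite KC in t2; rewrite -aK.
have -> : W - a ^+ K * cos b = (W - iter K (walk_op p upd z) G e 0) +
  (iter K (walk_op p upd z) G e 0 - a ^+ K * G e 0) -
  a ^+ K * (cos (s * 0 + b) - G e 0) by rewrite mulr0 add0r; ring.
apply: le_trans (ler_normB _ _) _.
have := ler_normD (W - iter K (walk_op p upd z) G e 0)
  (iter K (walk_op p upd z) G e 0 - a ^+ K * G e 0).
lra.
Qed.

(** The martingale [v + h e] has orthogonal increments bounded by [M], so its mean square grows
    linearly, and it differs from [v] by a bounded amount. *)
Lemma walk_op_sqr_le (R : realType) (E J : finType) (p : E -> J -> R)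
    (upd : E -> J -> E) (z : E -> J -> R)
    (p0 : forall e j, 0 <= p e j) (p1 : forall e, \sum_j p e j = 1)
    (h : E -> R)
    (D := fun e j => z e j + h (upd e j) - h e)
    (D0 : forall e, \sum_j p e j * D e j = 0) :
  exists C : R, forall (K : nat) (e : E), (0 < K)%N ->
    iter K (walk_op p upd z) (fun _ v => v ^+ 2) e 0 <= C * K%:R.
Proof.
have [Mh Mh1 hM] := bounded_finfun h.
have [MD MD1 DM] := bounded_finfun (fun x : E * J => D x.1 x.2).
pose M := Mh + MD.
have M1 : 1 <= M by rewrite /M; lra.
have {}hM e : `|h e| <= M by apply: le_trans (hM e) _; rewrite /M; lra.
have {}DM e j : `|D e j| <= M by apply: le_trans (DM (e, j)) _; rewrite /M; lra.
have sq (x : R) : `|x| <= M -> x ^+ 2 <= M ^+ 2.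
  move=> xM; rewrite -real_normK ?num_real //.
  by apply: lerXn2r; rewrite ?nnegrE //; lra.
pose G e v := 2 * (v + h e) ^+ 2 + 2 * M ^+ 2.
have GK K e v : iter K (walk_op p upd z) G e v <= G e v + K%:R * (2 * M ^+ 2).
  elim: K e v => [|K IH] e v; first by rewrite mul0r addr0.
  rewrite iterS.
  apply: (@le_trans _ _ (walk_op p upd z (fun e v => 1 * G e v + K%:R * (2 * M ^+ 2)) e v)).
    apply: (walk_op_le upd z p0 _ 1) => e' v'; by rewrite mul1r.
  rewrite walk_op_affine // mul1r -natr1.
  suff : walk_op p upd z G e v <= G e v + 2 * M ^+ 2 by lra.
  have -> : walk_op p upd z G e v = G e v * \sum_j p e j +
      4 * (v + h e) * \sum_j p e j * D e j + 2 * \sum_j p e j * D e j ^+ 2.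
    rewrite /walk_op !mulr_sumr -!big_split /=; apply: eq_bigr => j _.
    by rewrite /G /D; ring.
  rewrite p1 D0 mulr0 addr0 mulr1 lerD2l ler_pM2l //.
  rewrite -[leRHS]mul1r -(p1 e) mulr_suml; apply: ler_sum => j _.
  by rewrite ler_wpM2l // sq.
(* At [v = 0] the function [G] is at most [4 M^2], and [K] steps add [2 M^2] each. *)
exists (6 * M ^+ 2) => K e K0.
apply: (@le_trans _ _ (iter K (walk_op p upd z) G e 0)).
  apply: walk_op_le => // e' v; rewrite /G.
  have := sq _ (hM e'); have := sqr_ge0 (v + 2 * h e'); lra.
apply: le_trans (GK K e 0) _; rewrite /G add0r.
have K1 : 1 <= K%:R :> R by rewrite ler1n.
have := sq _ (hM e); have : 0 <= M ^+ 2 by rewrite sqr_ge0.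
set m := M ^+ 2; set u := h e ^+ 2; nra.
Qed.

(** * Expectations along a Markov chain *)

Lemma bounded_integrable (R : realType) (disp : measure_display)
    (T : measurableType disp) (Pr : probability T R) (f : T -> R) (C : R) :
  measurable_fun [set: T] f -> (forall x, `|f x| <= C) ->
  Pr.-integrable [set: T] (EFin \o f).
Proof.
move=> mf fC; apply: measurable_bounded_integrable => //.
  by rewrite ltey_eq fin_num_measure.
by exists C; split; [exact: num_real|move=> x Cx y _; exact: le_trans (fC y) (ltW Cx)].
Qed.

(** A functional of finitely many steps of the chain factors through a finite-valued map; this
    decomposition reduces its measurability and its integral to finite sums over events. *)
Lemma finite_valued_decomp (R : realType) (T : Type) (I : finType) (Y : T -> I)
    (f : I -> R) (w : T) :
  f (Y w) = \sum_i f i * \1_[set w | Y w = i] w.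
Proof.
rewrite (bigD1 (Y w)) //= indicE mem_set // mulr1 big1 ?addr0 // => i iY.
by rewrite indicE memNset ?mulr0 // => /= /eqP; rewrite eq_sym (negPf iY).
Qed.

Lemma measurable_finite_valued (R : realType) (disp : measure_display)
    (T : measurableType disp) (I : finType) (Y : T -> I)
    (mY : forall i, measurable [set w | Y w = i]) (f : I -> R) :
  measurable_fun [set: T] (fun w => f (Y w)).
Proof.
rewrite (_ : (fun w => _) = fun w => \sum_i f i * \1_[set w | Y w = i] w); last first.
  by apply/funext => w; exact: finite_valued_decomp.
by apply: measurable_sum => i; apply: measurable_funM.
Qed.

Lemma integrable_finite_valued (R : realType) (disp : measure_display)
    (T : measurableType disp) (Pr : probability T R) (I : finType) (Y : T -> I)
    (mY : forall i, measurable [set w | Y w = i]) (f : I -> R) :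
  Pr.-integrable [set: T] (EFin \o (fun w => f (Y w))).
Proof.
have [C _ fC] := bounded_finfun f.
by apply: (@bounded_integrable _ _ _ _ _ C) => //; exact: measurable_finite_valued.
Qed.

Lemma Rintegral_finite_valued (R : realType) (disp : measure_display)
    (T : measurableType disp) (Pr : probability T R) (I : finType) (Y : T -> I)
    (mY : forall i, measurable [set w | Y w = i]) (f : I -> R) :
  \int[Pr]_w f (Y w) = \sum_i f i * fine (Pr [set w | Y w = i]).
Proof.
rewrite /Rintegral.
have iY i : Pr.-integrable [set: T] (EFin \o (fun w => f i * \1_[set w | Y w = i] w)).
  apply: (@bounded_integrable _ _ _ _ _ `|f i|).
    by apply: measurable_funM => //; exact: measurable_indic.
  by move=> w; rewrite normrM ler_piMr // indicE; case: (_ \in _); rewrite ?normr1 ?normr0.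
transitivity (fine (\int[Pr]_w \sum_i (f i * \1_[set w | Y w = i] w)%:E)%E).
  by congr fine; apply: eq_integral => w _; rewrite sumEFin -finite_valued_decomp.
rewrite (integral_sum _ (fun i => iY i)) // -sum_fine; last first.
  by move=> i _; apply: integrable_fin_num => //; exact: iY.
apply: eq_bigr => i _.
under eq_integral do rewrite /= EFinM.
rewrite integralZl //; last first.
  by apply: integrable_indic => //; rewrite probability_setT ltry.
rewrite integral_indic // setIT fineM //.
exact: fin_num_measure.
Qed.

(** Both sides are sums over the cylinders of the first [K.+1] states, where the hypothesis on [Pr]
    factors out the last transition. [f_ext] says that [f] sees the trajectory only up to time
    [K]. *)
Lemma markov_chain_step (R : realType) (disp : measure_display)
    (T : measurableType disp) (Pr : probability T R) (d : nat) (P : 'M[R]_d)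
    (X : nat -> T -> 'I_d) (X_chain : markov_chain Pr P X) (K : nat)
    (f : (nat -> 'I_d) -> 'I_d -> R)
    (f_ext : forall x y, (forall k, (k <= K)%N -> x k = y k) -> f x = f y) :
  \int[Pr]_w f (X^~ w) (X K.+1 w) =
  \int[Pr]_w \sum_j P (X K w) j * f (X^~ w) j.
Proof.
case: X_chain => mX markovX.
pose I := {ffun 'I_K.+1 -> 'I_d}.
pose Y w : I := [ffun k : 'I_K.+1 => X k w].
(* Beyond [K], [inord] returns a default index; by [f_ext] these values do not affect [f]. *)
pose ext (y : I) (n : nat) := y (inord n).
have extY w k : (k <= K)%N -> ext (Y w) k = X k w.
  by move=> kK; rewrite /ext /Y ffunE inordK.
have fY w : f (X^~ w) = f (ext (Y w)).
  by apply: f_ext => k kK; rewrite extY.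
have cylE n (s : nat -> 'I_d) :
    [set w | forall k, (k <= n)%N -> X k w = s k] =
    \bigcap_(k in [set k | (k <= n)%N]) [set w | X k w = s k].
  by apply/seteqP; split.
have mcyl n (s : nat -> 'I_d) : measurable [set w | forall k, (k <= n)%N -> X k w = s k].
  by rewrite cylE; apply: bigcap_measurable => [|k _]; [exists 0%N|exact: mX].
have YE y : [set w | Y w = y] = [set w | forall k, (k <= K)%N -> X k w = ext y k].
  apply/seteqP; split=> w /= => [<- k kK|wy]; first by rewrite extY.
  by apply/ffunP => k; rewrite ffunE (wy k) ?(leq_ord k) // /ext inord_val.
have mY y : measurable [set w | Y w = y] by rewrite YE.
(* The finite path continued by the letter [yj.2] at time [K.+1], in the form that [markov_chain]
   expects. *)
pose s (yj : I * 'I_d) k := if k == K.+1 then yj.2 else ext yj.1 k.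
have YXE yj : [set w | (Y w, X K.+1 w) = yj] =
    [set w | forall k, (k <= K.+1)%N -> X k w = s yj k].
  apply/seteqP; split=> w /= => [<- k kK|wy]; rewrite /s.
    case: eqP => [->//|/eqP kn] /=.
    by rewrite extY // -ltnS ltn_neqAle kn.
  case: yj wy => y j wy; congr pair; last by rewrite (wy K.+1) // /s eqxx.
  suff : [set w | Y w = y] w by [].
  rewrite YE /= => k kK; rewrite wy ?(leq_trans kK) //.
  by rewrite /s (ltn_eqF (_ : k < K.+1)%N).
transitivity (\int[Pr]_w (fun yj : I * 'I_d => f (ext yj.1) yj.2) (Y w, X K.+1 w)).
  by apply: eq_Rintegral => w _ /=; rewrite fY.
have mYX yj : measurable [set w | (Y w, X K.+1 w) = yj] by rewrite YXE.
rewrite (Rintegral_finite_valued Pr mYX (fun yj => f (ext yj.1) yj.2)).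
transitivity (\int[Pr]_w (fun y : I => \sum_j P (ext y K) j * f (ext y) j) (Y w));
  last first.
  by apply: eq_Rintegral => w _ /=; rewrite fY extY.
rewrite (Rintegral_finite_valued Pr mY (fun y => \sum_j P (ext y K) j * f (ext y) j)).
transitivity (\sum_y \sum_j f (ext y) j * fine (Pr [set w | (Y w, X K.+1 w) = (y, j)])).
  by rewrite pair_bigA /=; apply: eq_bigr => -[].
apply: eq_bigr => y _; rewrite mulr_suml; apply: eq_bigr => j _.
rewrite YXE markovX YE fineM //; last by rewrite fin_num_measure.
have sy k : (k <= K)%N -> s (y, j) k = ext y k.
  by move=> kK; rewrite /s (ltn_eqF (_ : k < K.+1)%N).
rewrite sy // {2}/s eqxx /=.
have -> : [set w | forall k, (k <= K)%N -> X k w = s (y, j) k] =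
          [set w | forall k, (k <= K)%N -> X k w = ext y k].
  by apply/seteqP; split => w wy k kK; rewrite wy ?sy.
by ring.
Qed.

(** The value [x 0] only fixes the initial state and contributes no increment; step number [K] reads
    the letter [x K]. *)
Fixpoint walk_run (E J : Type) (V : zmodType) (init : J -> E) (upd : E -> J -> E)
    (z : E -> J -> V) (x : nat -> J) (K : nat) : E * V :=
  if K is K'.+1 then
    let ev := walk_run init upd z x K' in
    (upd ev.1 (x K), ev.2 + z ev.1 (x K))
  else (init (x 0%N), 0).

Lemma walk_run_ext (E J : Type) (V : zmodType) (init : J -> E)
    (upd : E -> J -> E) (z : E -> J -> V) (x y : nat -> J) (K : nat) :
  (forall k, (k <= K)%N -> x k = y k) ->
  walk_run init upd z x K = walk_run init upd z y K.
Proof.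
elim: K => [xy|K IH xy] /=; first by rewrite xy.
by rewrite IH ?xy // => k kK; rewrite xy // ltnW.
Qed.

(** Conditioning on all but the last step replaces [G] by its image under [walk_op]; hence [G] must
    be general in the induction. The component [pos] of the enriched state is the chain itself, so
    it supplies the transition probabilities. *)
Lemma Rintegral_walk_run (R : realType) (disp : measure_display)
    (T : measurableType disp) (Pr : probability T R) (d : nat) (P : 'M[R]_d)
    (X : nat -> T -> 'I_d) (X_chain : markov_chain Pr P X)
    (E : finType) (init : 'I_d -> E) (upd : E -> 'I_d -> E) (pos : E -> 'I_d)
    (pos_init : forall i, pos (init i) = i)
    (pos_upd : forall e j, pos (upd e j) = j)
    (z : E -> 'I_d -> R) (K : nat) (G : E -> R -> R) :
  \int[Pr]_w (let ev := walk_run init upd z (X^~ w) K in G ev.1 ev.2) =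
  \int[Pr]_w iter K (walk_op (fun e j => P (pos e) j) upd z) G (init (X 0%N w)) 0.
Proof.
elim: K G => [//|K IH] G; rewrite iterSr -IH.
rewrite (@markov_chain_step _ _ _ _ _ _ _ X_chain K (fun x j =>
  let ev := walk_run init upd z x K in G (upd ev.1 j) (ev.2 + z ev.1 j))); last first.
  by move=> x y xy; rewrite (walk_run_ext _ _ _ xy).
apply: eq_Rintegral => w _; rewrite /walk_op /=; apply: eq_bigr => j _.
congr (P _ _ * _).
by case: (K) => [|k] /=; rewrite ?pos_init ?pos_upd.
Qed.

(** * Trigonometric approximation *)

(** Near [x] uniform continuity gives [eps]; far away the bound [2 C] is absorbed by a multiple of
    the squared distance. Only [x] lies in the box, so the estimate can be averaged over an
    unbounded random [y] of known second moment. *)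
Lemma bounded_continuous_modulus (R : realType) (n : nat) (f : 'rV[R]_n -> R)
    (C : R) (fcont : continuous f) (fC : forall x, `|f x| <= C) (L eps : R) :
  0 < eps -> exists2 c : R, 0 <= c & forall x y : 'rV[R]_n,
    (forall i, `|x 0 i| <= L) ->
    `|f y - f x| <= eps + c * \sum_i (y 0 i - x 0 i) ^+ 2.
Proof.
move=> eps0.
have C0 : 0 <= C by exact: le_trans (normr_ge0 (f 0)) (fC 0).
have Kc := @rV_compact R n (fun=> `[- L, L]%classic) (fun=> @segment_compact R (- L) L).
pose P (d : R) (x : 'rV[R]_n) :=
  forall y : 'rV[R]_n, (forall i, `|y 0 i - x 0 i| < d) -> `|f y - f x| <= eps.
(* Compactness as near covering along [d] tending to 0 from the right: a modulus valid around each
   point becomes one [d] for the whole box. *)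
have := (compact_near_coveringP _).1 Kc R (0^'+) P (@at_right_proper_filter R 0).
move=> /(_ _) [|d0 /= d00 dP].
  move=> x _.
  have /cvgrPdist_lt /(_ (eps / 2)) := fcont x.
  move=> /(_ _)/nbhs_ballP[|r /= r0 rP]; first by rewrite divr_gt0.
  have r20 : 0 < r / 2 by rewrite divr_gt0.
  exists (ball x (r / 2), [set d | d < r / 2]).
    by split; [exact: nbhsx_ballx|exact: nbhs_right_lt].
  move=> [x' d] /= [bx dr] y yx'.
  have x'x i : `|x 0 i - x' 0 i| < r / 2.
    by case: bx => _ bx; exact: (bx 0 i).
  have h1 : `|f x - f x'| < eps / 2.
    apply: rP; split=> // i j.
    by rewrite /ball /= (ord1 i); have := x'x j; lra.
  have h2 : `|f x - f y| < eps / 2.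
    apply: rP; split=> // i j; rewrite (ord1 i) /ball /=.
    have -> : x 0 j - y 0 j = (x 0 j - x' 0 j) - (y 0 j - x' 0 j) by ring.
    by apply: le_lt_trans (ler_normB _ _) _; have := x'x j; have := yx' j; lra.
  have -> : f y - f x' = (f x - f x') - (f x - f y) by ring.
  by apply: le_trans (ler_normB _ _) _; lra.
have d20 : 0 < d0 / 2 by rewrite divr_gt0.
have c0 : 0 <= 2 * C / (d0 / 2) ^+ 2.
  by rewrite mulr_ge0 ?invr_ge0 ?sqr_ge0 // mulr_ge0.
exists (2 * C / (d0 / 2) ^+ 2) => // x y xL.
have [yx|] := boolP [forall i, `|y 0 i - x 0 i| < d0 / 2].
  apply: le_trans (dP (d0 / 2) _ _ x _ y _) _.
  - by rewrite /= sub0r normrN gtr0_norm //; lra.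
  - by [].
  - by move=> i /=; rewrite in_itv /=; have := xL i; rewrite ler_norml.
  - exact/forallP.
  by rewrite lerDl mulr_ge0 // sumr_ge0 // => i _; rewrite sqr_ge0.
move=> /forallPn[i]; rewrite -leNgt => yi.
have q2 : (d0 / 2) ^+ 2 <= \sum_i (y 0 i - x 0 i) ^+ 2.
  rewrite (bigD1 i) //= -[leLHS]addr0 lerD ?sumr_ge0 // => [|j _]; last exact: sqr_ge0.
  by rewrite -[leRHS]real_normK ?num_real // ler_sqr ?nnegrE // ltW.
apply: (@le_trans _ _ (2 * C)).
  by apply: le_trans (ler_normB _ _) _; have := fC x; have := fC y; lra.
apply: (@le_trans _ _ (2 * C / (d0 / 2) ^+ 2 * \sum_i (y 0 i - x 0 i) ^+ 2)); last first.
  by rewrite lerDr ltW.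
rewrite -mulrA ler_peMr ?mulr_ge0 // mulrC ler_pdivlMr ?mul1r //.
by rewrite exprn_gt0.
Qed.

(** An inductive predicate rather than explicit coefficients, so that measurability, boundedness and
    convergence of integrals follow by induction from the single cosine. *)
Inductive trig_poly (R : realType) (n : nat) : ('rV[R]_n -> R) -> Prop :=
| trig_poly_cos u b : trig_poly (fun x : 'rV[R]_n => cos (\sum_i (u : 'rV[R]_n) 0 i * x 0 i + b))
| trig_polyD p q : trig_poly p -> trig_poly q -> trig_poly (fun x => p x + q x)
| trig_polyZ a p : trig_poly p -> trig_poly (fun x => a * p x).

Lemma trig_poly_cst (R : realType) (n : nat) (c : R) :
  trig_poly (fun _ : 'rV[R]_n => c).
Proof.
have := trig_polyZ c (trig_poly_cos (0 : 'rV[R]_n) 0).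
congr trig_poly; apply/funext => x.
by rewrite big1 ?addr0 ?cos0 ?mulr1 // => i _; rewrite mxE mul0r.
Qed.

Lemma trig_poly_sum (R : realType) (n : nat) (I : Type) (s : seq I)
    (p : I -> 'rV[R]_n -> R) : (forall i, trig_poly (p i)) ->
  trig_poly (fun x => \sum_(i <- s) p i x).
Proof.
move=> tp; elim: s => [|i s IH].
  rewrite (_ : (fun x => _) = fun=> 0); first exact: trig_poly_cst.
  by apply/funext => x; rewrite big_nil.
rewrite (_ : (fun x => _) = fun x : 'rV[R]_n => p i x + \sum_(j <- s) p j x).
  exact: trig_polyD.
by apply/funext => x; rewrite big_cons.
Qed.

Lemma trig_polyM (R : realType) (n : nat) (p q : 'rV[R]_n -> R) :
  trig_poly p -> trig_poly q -> trig_poly (fun x => p x * q x).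
Proof.
move=> tp tq; elim: tp => {p} [u b|p p' _ IH _ IH'|a p _ IH]; first last.
- rewrite (_ : (fun x => _) = fun x : 'rV[R]_n => a * (p x * q x)); first exact: trig_polyZ.
  by apply/funext => x; rewrite mulrA.
- rewrite (_ : (fun x => _) = fun x : 'rV[R]_n => p x * q x + p' x * q x); first exact: trig_polyD.
  by apply/funext => x; rewrite mulrDl.
elim: tq => {q} [v c|p p' _ IH _ IH'|a p _ IH]; first last.
- rewrite (_ : (fun x => _) = fun x : 'rV[R]_n => a * (cos (\sum_i u 0 i * x 0 i + b) * p x)).
    exact: trig_polyZ.
  by apply/funext => x; rewrite mulrCA.
- rewrite (_ : (fun x => _) = fun x : 'rV[R]_n => cos (\sum_i u 0 i * x 0 i + b) * p x +
      cos (\sum_i u 0 i * x 0 i + b) * p' x); first exact: trig_polyD.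
  by apply/funext => x; rewrite mulrDr.
have := trig_polyZ (1 / 2) (trig_polyD (trig_poly_cos (u + v) (b + c))
  (trig_poly_cos (u - v) (b - c))).
congr trig_poly; apply/funext => x.
have -> : \sum_i (u + v) 0 i * x 0 i = \sum_i u 0 i * x 0 i + \sum_i v 0 i * x 0 i.
  by rewrite -big_split; apply: eq_bigr => i _; rewrite mxE mulrDl.
have -> : \sum_i (u - v) 0 i * x 0 i = \sum_i u 0 i * x 0 i - \sum_i v 0 i * x 0 i.
  by rewrite -sumrB; apply: eq_bigr => i _; rewrite !mxE mulrBl.
rewrite addrACA [X in _ * (_ + cos X)](_ : _ = (\sum_i u 0 i * x 0 i + b) -
  (\sum_i v 0 i * x 0 i + c)); last by ring.
by rewrite cosD cosB; field.
Qed.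

Lemma trig_poly_sin (R : realType) (n : nat) (k : R) (i : 'I_n) :
  trig_poly (fun x : 'rV[R]_n => sin (k * x 0 i)).
Proof.
have := trig_poly_cos (- k *: delta_mx 0 i : 'rV[R]_n) (pi / 2).
congr trig_poly; apply/funext => x.
rewrite (bigD1 i) //= big1 ?addr0 => [|j ji].
  by rewrite !mxE !eqxx mulr1 cosDpihalf mulNr sinN opprK.
by rewrite !mxE (negPf ji) /= mulr0 mul0r.
Qed.

(** * Biased random walks along the axes *)

Lemma iter_walk_op_bound (R : realType) (E J : finType) (V : zmodType)
    (p : E -> J -> R) (upd : E -> J -> E) (z : E -> J -> V)
    (p0 : forall e j, 0 <= p e j) (p1 : forall e, \sum_j p e j = 1)
    (G : E -> V -> R) (C : R) (K : nat) (e : E) (v : V) :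
  (forall e v, `|G e v| <= C) -> `|iter K (walk_op p upd z) G e v| <= C.
Proof.
move=> GC.
have z0 k e' v' : iter k (walk_op p upd z) (fun _ _ => 0) e' v' = 0.
  elim: k e' v' => [//|k IH] e' v'; rewrite iterS /walk_op big1 // => j _.
  by rewrite IH mulr0.
have := walk_op_close upd z p0 p1 (G := G) (H := fun _ _ => 0) (c := C) _ K e v.
by rewrite z0 subr0; apply => e' v'; rewrite subr0.
Qed.

Lemma iter_walk_op_affine (R : realType) (E J : finType) (V : zmodType)
    (p : E -> J -> R) (upd : E -> J -> E) (z : E -> J -> V)
    (p1 : forall e, \sum_j p e j = 1) (G : E -> V -> R) (a c : R) (K : nat) e v :
  iter K (walk_op p upd z) (fun e v => a * G e v + c) e v =
  a * iter K (walk_op p upd z) G e v + c.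
Proof.
elim: K e v => [//|K IH] e v; rewrite !iterS -walk_op_affine //.
by rewrite /walk_op; apply: eq_bigr => j _; rewrite IH.
Qed.

(* A step of length [a] along a uniformly chosen axis i, in the direction of
   sign s i on average. *)
Definition axis_prob (R : realType) (n : nat) (s : 'I_n -> R) (_ : unit)
    (j : 'I_n * bool) : R := (1 + (-1) ^+ j.2 * s j.1) / (2 * n%:R).

Definition axis_step (R : realType) (n : nat) (a : R) (_ : unit)
    (j : 'I_n * bool) : 'rV[R]_n := (-1) ^+ j.2 * a *: delta_mx 0 j.1.

(** The internal state is [unit]: the steps are independent and identically distributed. *)
Definition axis_op (R : realType) (n : nat) (s : 'I_n -> R) (a : R) :=
  walk_op (axis_prob s) (fun e _ => e) (axis_step a : unit -> 'I_n * bool -> 'rV[R]_n).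

Lemma sum_axis (R : realType) (n : nat) (F : 'I_n * bool -> R) :
  \sum_j F j = \sum_i (F (i, true) + F (i, false)).
Proof.
transitivity (\sum_i \sum_b F (i, b)); first by rewrite pair_bigA; apply: eq_bigr => -[].
by apply: eq_bigr => i _; rewrite big_bool.
Qed.

Lemma axis_prob_ge0 (R : realType) (n : nat) (s : 'I_n -> R) e j :
  (forall i, `|s i| <= 1) -> 0 <= axis_prob s e j.
Proof.
move=> s1; rewrite /axis_prob divr_ge0 ?mulr_ge0 //.
have := s1 j.1; rewrite ler_norml; case: j.2; rewrite ?expr1 ?expr0; lra.
Qed.

Lemma axis_prob_sum (R : realType) (n : nat) (s : 'I_n -> R) e : (0 < n)%N ->
  \sum_j axis_prob s e j = 1.
Proof.
move=> n0; have nR : n%:R != 0 :> R by rewrite pnatr_eq0 -lt0n.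
rewrite sum_axis /axis_prob (eq_bigr (fun=> n%:R^-1)) => [|i _].
  by rewrite sumr_const card_ord -[_ *+ n]mulr_natl divff.
by rewrite /= expr1 expr0; field.
Qed.

(** Squared bias plus variance: a step has mean [a * s i / n] in coordinate [i] and squared length
    [a ^+ 2], which bounds its total variance. *)
Lemma axis_op_sqr (R : realType) (n : nat) (s : 'I_n -> R) (a : R) (N : nat)
    (c v : 'rV[R]_n) : (0 < n)%N -> (forall i, `|s i| <= 1) ->
  iter N (axis_op s a) (fun _ v => \sum_i (v 0 i - c 0 i) ^+ 2) tt v <=
  \sum_i (v 0 i + N%:R * (a * s i / n%:R) - c 0 i) ^+ 2 + N%:R * a ^+ 2.
Proof.
move=> n0 s1; have nR : n%:R != 0 :> R by rewrite pnatr_eq0 -lt0n.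
have p0 := axis_prob_ge0 _ _ s1; have p1 := axis_prob_sum s _ n0.
have one (c' v' : 'rV[R]_n) : axis_op s a (fun _ v => \sum_i (v 0 i - c' 0 i) ^+ 2) tt v' <=
    \sum_i (v' 0 i + a * s i / n%:R - c' 0 i) ^+ 2 + a ^+ 2.
  have step (t : R) i : \sum_k ((v' + t *: delta_mx 0 i) 0 k - c' 0 k) ^+ 2 =
      \sum_k (v' 0 k - c' 0 k) ^+ 2 + 2 * t * (v' 0 i - c' 0 i) + t ^+ 2.
    rewrite (bigD1 i) //= [in RHS](bigD1 i) //= !mxE !eqxx mulr1.
    rewrite (eq_bigr (fun k => (v' 0 k - c' 0 k) ^+ 2)) => [|k ki]; first by ring.
    by rewrite !mxE (negPf ki) /= mulr0 addr0.
  have avg (t : R) : \sum_(i < n) t / n%:R = t.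
    by rewrite sumr_const card_ord -[_ *+ n]mulr_natl mulrCA divff // mulr1.
  rewrite /axis_op /walk_op /axis_step sum_axis.
  rewrite (eq_bigr (fun i => (\sum_k (v' 0 k - c' 0 k) ^+ 2) / n%:R +
     2 * (v' 0 i - c' 0 i) * (a * s i / n%:R) + a ^+ 2 / n%:R)) => [|i _]; last first.
    rewrite !step /axis_prob /= expr1 expr0; by field.
  rewrite !big_split /= !avg.
  rewrite lerD2r -big_split /=; apply: ler_sum => i _.
  have := sqr_ge0 (a * s i / n%:R); set mu := _ / _; nra.
elim: N v => [|N IH] v.
  by rewrite !mul0r !addr0; apply: ler_sum => i _; rewrite mul0r addr0.
rewrite iterS.
(* The target as seen before the first step: the drift of the [N] later steps is moved from the
   position to the target. *)
pose c' : 'rV[R]_n := c - \row_i (N%:R * (a * s i / n%:R)).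
apply: (@le_trans _ _ (axis_op s a (fun _ v => 1 * \sum_i (v 0 i - c' 0 i) ^+ 2 + N%:R * a ^+ 2) tt v)).
  apply: (walk_op_le _ _ p0 _ 1) => -[] v'; apply: le_trans (IH v') _.
  rewrite mul1r lerD2r; apply: ler_sum => i _; rewrite !mxE.
  by rewrite le_eqVlt; apply/orP; left; apply/eqP; congr (_ ^+ 2); ring.
rewrite /axis_op walk_op_affine // mul1r -natr1 mulrDl mul1r [N%:R * _ + _]addrC addrA lerD2r.
apply: le_trans (one c' v) _; rewrite lerD2r; apply: ler_sum => i _; rewrite !mxE.
by rewrite le_eqVlt; apply/orP; left; apply/eqP; congr (_ ^+ 2); ring.
Qed.

(** The point [x] enters only through the step probabilities, affine in the [sin (k * x 0 i)]; the
    expectation is a polynomial in these sines with values of [f] as coefficients. *)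
Lemma trig_poly_axis_op (R : realType) (n : nat) (k a : R) (f : 'rV[R]_n -> R)
    (N : nat) (v : 'rV[R]_n) :
  trig_poly (fun x : 'rV[R]_n =>
    iter N (axis_op (fun i => sin (k * x 0 i)) a) (fun _ => f) tt v).
Proof.
elim: N v => [|N IH] v; first exact: trig_poly_cst.
rewrite (_ : (fun x => _) = fun x : 'rV[R]_n => \sum_j axis_prob (fun i => sin (k * x 0 i)) tt j *
  iter N (axis_op (fun i => sin (k * x 0 i)) a) (fun _ => f) tt (v + axis_step a tt j)).
  apply: trig_poly_sum => j; apply: trig_polyM => //.
  rewrite (_ : (fun x => _) = fun x : 'rV[R]_n => (2 * n%:R)^-1 * (1 + (-1) ^+ j.2 * sin (k * x 0 j.1))).
    apply/trig_polyZ/trig_polyD; first exact: trig_poly_cst.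
    exact/trig_polyZ/trig_poly_sin.
  by apply/funext => x; rewrite /axis_prob mulrC.
by apply/funext => x; rewrite iterS.
Qed.

(* A random-walk version of Bernstein's operator: for small k, N steps of
   length n / (k N) started at 0 end near the point with coordinates
   sin (k x_i) / k, hence near x. *)
Lemma trig_approx (R : realType) (n : nat) (f : 'rV[R]_n -> R) (C : R)
    (fcont : continuous f) (fC : forall x, `|f x| <= C) (L eps : R) :
  0 < L -> 0 < eps -> exists p : 'rV[R]_n -> R,
    [/\ trig_poly p, forall x, `|p x| <= C &
      forall x : 'rV[R]_n, (forall i, `|x 0 i| <= L) -> `|f x - p x| <= eps].
Proof.
move=> L0 eps0; case: n => [|n] in f fcont fC *.
  exists (fun=> f 0); split => //; first exact: trig_poly_cst.
  by move=> x _; rewrite (thinmx0 x) subrr normr0 ltW.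
have eps4 : 0 < eps / 4 by rewrite divr_gt0.
have [c c0 fmod] := bounded_continuous_modulus fcont fC L eps4.
pose m := n.+1%:R : R.
have m0 : 0 < m by rewrite ltr0n.
(* Replacing [x_i] by [sin (k x_i) / k] costs at most [k^2 L^3 / 2] per coordinate; [k] is small
   enough that the quadratic modulus of this displacement is below [eps / 4]. *)
pose k := Num.min 1 (eps / 4 / (c * m * L ^+ 6 + 1)).
have cL : 0 <= c * m * L ^+ 6 by rewrite !mulr_ge0 ?exprn_ge0 // ltW.
have k0 : 0 < k by rewrite lt_min ltr01 divr_gt0 // ltr_wpDl.
have k1 : k <= 1 by rewrite ge_min lexx.
have kL : c * m * L ^+ 6 * k <= eps / 4.
  apply: (@le_trans _ _ ((c * m * L ^+ 6 + 1) * k)).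
    by rewrite ler_wpM2r ?(ltW k0) // lerDl.
  by rewrite mulrC -ler_pdivlMr ?ltr_wpDl // ge_min lexx orbT.
(* The step [a] below makes the total drift exactly [s_i / k]; the variance is then
   [N a^2 = m^2 / (k^2 N)], and [N] brings [c] times it below [eps / 4]. *)
pose N := (Num.truncn (c * m ^+ 2 / (k ^+ 2 * (eps / 4)))).+1.
have NR : 0 < N%:R :> R by rewrite ltr0n.
pose a := m / (k * N%:R).
have aN : c * (N%:R * a ^+ 2) <= eps / 4.
  have : c * m ^+ 2 / (k ^+ 2 * (eps / 4)) < N%:R by exact: truncnS_gt.
  rewrite ltr_pdivrMr ?mulr_gt0 ?exprn_gt0 // => /ltW cN.
  have -> : c * (N%:R * a ^+ 2) = c * m ^+ 2 / (k ^+ 2 * N%:R).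
    by rewrite /a; field; rewrite !gt_eqF.
  rewrite ler_pdivrMr ?mulr_gt0 ?exprn_gt0 //; apply: le_trans cN _.
  by rewrite le_eqVlt; apply/orP; left; apply/eqP; ring.
pose s (x : 'rV[R]_n.+1) i := sin (k * x 0 i).
have s1 x i : `|s x i| <= 1 by exact: norm_sin_le1.
have p0 x := axis_prob_ge0 _ _ (s1 x); have p1 x := axis_prob_sum (s x) _ (ltn0Sn n).
exists (fun x => iter N (axis_op (s x) a) (fun _ => f) tt 0); split.
- exact: trig_poly_axis_op.
- by move=> x; apply: iter_walk_op_bound => //.
move=> x xL; set p := iter _ _ _ _ _.
pose y : 'rV[R]_n.+1 := \row_i (s x i / k).
have yx i : `|y 0 i - x 0 i| <= k ^+ 2 * L ^+ 3 / 2.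
  have -> : y 0 i - x 0 i = - ((k * x 0 i - s x i) / k).
    by rewrite mxE; field; rewrite gt_eqF.
  rewrite normrN normrM (gtr0_norm (x := k^-1)) ?invr_gt0 // ler_pdivrMr //.
  apply: le_trans (norm_sub_sin_le _) _; rewrite normrM (gtr0_norm k0) exprMn.
  have -> : k ^+ 2 * L ^+ 3 / 2 * k = k ^+ 3 * L ^+ 3 / 2 by ring.
  rewrite ler_pM2r ?invr_gt0 // ler_pM2l ?exprn_gt0 //.
  by apply: lerXn2r; rewrite ?nnegrE // ltW.
(* Since [|sin z| <= |z|], the endpoint [y] stays in the box, so the modulus may also be used around
   [y]. *)
have yL i : `|y 0 i| <= L.
  rewrite mxE normrM (gtr0_norm (x := k^-1)) ?invr_gt0 // ler_pdivrMr //.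
  apply: le_trans (norm_sin_le _) _.
  by rewrite normrM (gtr0_norm k0) mulrC ler_wpM2r // ltW.
have fyx : `|f y - f x| <= eps / 2.
  apply: le_trans (fmod x y xL) _.
  suff : c * \sum_i (y 0 i - x 0 i) ^+ 2 <= eps / 4 by lra.
  apply: le_trans kL.
  apply: (@le_trans _ _ (c * (m * (k ^+ 2 * L ^+ 3 / 2) ^+ 2))).
    rewrite ler_wpM2l // /m -[X in X%:R]card_ord mulr_natl -sumr_const.
    apply: ler_sum => i _; rewrite -[leLHS]real_normK ?num_real //.
    by apply: lerXn2r; rewrite ?nnegrE // ?mulr_ge0 ?exprn_ge0 // ltW.
  have -> : c * (m * (k ^+ 2 * L ^+ 3 / 2) ^+ 2) = c * m * L ^+ 6 * (k ^+ 4 / 4) by field.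
  rewrite ler_wpM2l //.
  have k3 : k ^+ 3 <= 1 by rewrite exprn_ile1 // ltW.
  by have : k ^+ 4 <= k; [rewrite exprS ler_piMr // ltW|lra].
(* Started at 0 with target [y], the walk has no bias, so only the variance term survives. *)
have q := axis_op_sqr a N y 0 (ltn0Sn n) (s1 x).
rewrite big1 ?add0r in q => [|i _]; last first.
  rewrite /y !mxE /a -[n.+1%:R]/m add0r -[RHS](expr0n R 2); congr (_ ^+ 2).
  by field; rewrite !gt_eqF.
set Q := iter _ _ _ _ _ in q.
have cq : c * Q <= eps / 4 by apply: le_trans aN; rewrite ler_wpM2l.
(* [f] lies between [f y] plus or minus [eps / 4] and a quadratic in the distance to [y]; the
   positive operator preserves both inequalities. *)
have up : p <= c * Q + (f y + eps / 4).
  rewrite /p /Q -iter_walk_op_affine //; apply: walk_op_le => // _ v.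
  by have := fmod y v yL; rewrite ler_norml; lra.
have lo : (- c) * Q + (f y - eps / 4) <= p.
  rewrite /p /Q -iter_walk_op_affine //; apply: walk_op_le => // _ v.
  by have := fmod y v yL; rewrite ler_norml; lra.
by move: fyx; rewrite !ler_norml; lra.
Qed.

(** * Convergence in distribution from cosines *)

Lemma measurable_linear_form (R : realType) (disp : measure_display)
    (T : measurableType disp) (n : nat) (Z : T -> 'rV[R]_n) (u : 'rV[R]_n) :
  random_vector Z -> measurable_fun [set: T] (fun w => \sum_i u 0 i * Z w 0 i).
Proof. by move=> mZ; apply: measurable_sum => i; apply: measurable_funM. Qed.

Lemma measurable_cos_comp (R : realType) (disp : measure_display)
    (T : measurableType disp) (X : T -> R) :
  measurable_fun [set: T] X -> measurable_fun [set: T] (fun w => cos (X w)).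
Proof.
move=> mX; apply: (measurableT_comp (f := cos)) => //.
by apply: continuous_measurable_fun; exact: continuous_cos.
Qed.

Lemma measurable_trig_poly (R : realType) (disp : measure_display)
    (T : measurableType disp) (n : nat) (Z : T -> 'rV[R]_n) (p : 'rV[R]_n -> R) :
  random_vector Z -> trig_poly p -> measurable_fun [set: T] (fun w => p (Z w)).
Proof.
move=> mZ; elim=> {p} [u b|p q _ mp _ mq|a p _ mp].
- apply: measurable_cos_comp; apply: measurable_funD => //.
  exact: measurable_linear_form.
- exact: measurable_funD.
- exact: measurable_funM.
Qed.

Lemma trig_poly_bounded (R : realType) (n : nat) (p : 'rV[R]_n -> R) :
  trig_poly p -> exists C, forall x, `|p x| <= C.
Proof.
elim=> {p} [u b|p q _ [C pC] _ [D qD]|a p _ [C pC]].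
- by exists 1 => x; exact: norm_cos_le1.
- by exists (C + D) => x; apply: le_trans (ler_normD _ _) _; exact: lerD.
- by exists (`|a| * C) => x; exact: normM_le.
Qed.

Lemma integrable_trig_poly (R : realType) (disp : measure_display)
    (T : measurableType disp) (Pr : probability T R) (n : nat)
    (Z : T -> 'rV[R]_n) (p : 'rV[R]_n -> R) : random_vector Z -> trig_poly p ->
  Pr.-integrable [set: T] (EFin \o (fun w => p (Z w))).
Proof.
move=> mZ tp; have [C pC] := trig_poly_bounded tp.
apply: (@bounded_integrable _ _ _ _ _ C) => //; exact: measurable_trig_poly.
Qed.

(** [random_vector] only speaks of coordinates; composites with [f] are pointwise limits of
    trigonometric polynomials that approximate [f] on growing boxes. *)
Lemma measurable_bounded_continuous (R : realType) (disp : measure_display)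
    (T : measurableType disp) (n : nat) (Z : T -> 'rV[R]_n) (f : 'rV[R]_n -> R)
    (C : R) : random_vector Z -> continuous f -> (forall x, `|f x| <= C) ->
  measurable_fun [set: T] (fun w => f (Z w)).
Proof.
move=> mZ fcont fC.
have /choice[p pP] (N : nat) : exists p : 'rV[R]_n -> R, trig_poly p /\
    forall x : 'rV[R]_n, (forall i, `|x 0 i| <= N.+1%:R) -> `|f x - p x| <= N.+1%:R^-1.
  have N0 : 0 < N.+1%:R :> R by rewrite ltr0n.
  have [p [tp _ pf]] := trig_approx fcont fC N0 (eps := N.+1%:R^-1) ltac:(by rewrite invr_gt0).
  by exists p.
apply: (@measurable_fun_cvg _ _ _ _ (fun N w => p N (Z w))).
  by move=> N; apply: measurable_trig_poly (pP N).1.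
move=> w _; apply/cvgrPdist_le => /= e e0.
have [B B1 ZB] := bounded_finfun (fun i => Z w 0 i).
near=> N; apply: (@le_trans _ _ N.+1%:R^-1).
  apply: (pP N).2 => i; apply: le_trans (ZB i) _; apply: ltW.
  by near: N; exists (Num.truncn B) => // N /= BN; apply: lt_le_trans (truncnS_gt B) _; rewrite ler_nat ltnS.
rewrite -[leRHS]invrK lef_pV2 ?posrE ?invr_gt0 ?ltr0n // ltW //.
by near: N; exists (Num.truncn e^-1) => // N /= BN; apply: lt_le_trans (truncnS_gt _) _; rewrite ler_nat ltnS.
Unshelve. all: by end_near. Qed.

Definition square_norm (R : realType) (n : nat) (x : 'rV[R]_n) : R :=
  \sum_i x 0 i ^+ 2.

(** The polynomial is chosen before the probability space, so one choice serves a whole sequence and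
    its limit. Outside the box [|f - p| <= 2 C], which Chebyshev's argument bounds by
    [2 C |x|^2 / L^2]. *)
Lemma trig_poly_dense (R : realType) (n : nat) (f : 'rV[R]_n -> R) (C m eps : R) :
  continuous f -> (forall x, `|f x| <= C) -> 0 < eps ->
  exists2 p : 'rV[R]_n -> R, trig_poly p &
    forall (disp : measure_display) (T : measurableType disp)
      (Pr : probability T R) (Z : T -> 'rV[R]_n), random_vector Z ->
      Pr.-integrable [set: T] (EFin \o (fun w => square_norm (Z w))) ->
      \int[Pr]_w square_norm (Z w) <= m ->
      `|\int[Pr]_w f (Z w) - \int[Pr]_w p (Z w)| <= eps.
Proof.
move=> fcont fC eps0.
have C0 : 0 <= C by exact: le_trans (normr_ge0 (f 0)) (fC 0).
have eps2 : 0 < eps / 2 by rewrite divr_gt0.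
(* Makes [2 C |m| / L^2 <= eps / 2], using [L <= L^2]. *)
pose L := 1 + 2 * C * `|m| / (eps / 2).
have L1 : 1 <= L by rewrite lerDl divr_ge0 ?mulr_ge0 // ltW.
have L0 : 0 < L by lra.
have [p [tp pC pf]] := trig_approx fcont fC L0 eps2.
exists p => // disp T Pr Z mZ iZ Zm.
have c0 : 0 <= 2 * C / L ^+ 2 by rewrite divr_ge0 ?sqr_ge0 ?mulr_ge0.
have sn0 (x : 'rV[R]_n) : 0 <= square_norm x by rewrite sumr_ge0 // => i _; rewrite sqr_ge0.
have key x : `|f x - p x| <= eps / 2 + 2 * C / L ^+ 2 * square_norm x.
  have [xL|] := boolP [forall i, `|x 0 i| <= L].
    apply: (@le_trans _ _ (eps / 2)); first exact/pf/forallP.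
    by rewrite lerDl mulr_ge0.
  move=> /forallPn[i]; rewrite -ltNge => xi.
  apply: (@le_trans _ _ (2 * C)).
    by apply: le_trans (ler_normB _ _) _; have := fC x; have := pC x; lra.
  apply: (@le_trans _ _ (2 * C / L ^+ 2 * square_norm x)); last by rewrite lerDr ltW.
  rewrite -mulrA ler_peMr ?mulr_ge0 // mulrC ler_pdivlMr ?mul1r ?exprn_gt0 //.
  rewrite /square_norm (bigD1 i) //= -[leLHS]addr0 lerD ?sumr_ge0 // => [|j _]; last exact: sqr_ge0.
  by rewrite -[leRHS]real_normK ?num_real // ler_sqr ?nnegrE // ltW.
have mf : measurable_fun [set: T] (fun w => f (Z w)).
  exact: measurable_bounded_continuous mZ fcont fC.
have if_ : Pr.-integrable [set: T] (EFin \o (fun w => f (Z w))).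
  exact: (@bounded_integrable _ _ _ _ _ C).
have ip := integrable_trig_poly Pr mZ tp.
have ifp : Pr.-integrable [set: T] (EFin \o (fun w => f (Z w) - p (Z w))).
  apply: (@bounded_integrable _ _ _ _ _ (C + C)).
    by apply: measurable_funB => //; exact: measurable_trig_poly.
  by move=> w; apply: le_trans (ler_normB _ _) _; exact: lerD.
rewrite -RintegralB //; apply: le_trans (le_normr_Rintegral _ ifp) _ => //.
have ic : Pr.-integrable [set: T] (EFin \o (fun=> eps / 2)).
  by apply: (@bounded_integrable _ _ _ _ _ (eps / 2)) => // w; rewrite ger0_norm // ltW.
have iZc : Pr.-integrable [set: T] (EFin \o (fun w => 2 * C / L ^+ 2 * square_norm (Z w))).
  exact: (integrableZl measurableT (2 * C / L ^+ 2) iZ).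
apply: (@le_trans _ _ (\int[Pr]_w (eps / 2 + 2 * C / L ^+ 2 * square_norm (Z w)))).
  apply: le_Rintegral => //.
    exact: integrable_norm ifp.
  exact: (integrableD measurableT ic iZc).
rewrite RintegralD // (RintegralZl (2 * C / L ^+ 2)) // (Rintegral_cst _ measurableT).
have -> : fine (Pr [set: T]) = 1 by rewrite probability_setT.
rewrite mulr1.
suff : 2 * C / L ^+ 2 * \int[Pr]_w square_norm (Z w) <= eps / 2 by lra.
apply: (@le_trans _ _ (2 * C / L ^+ 2 * `|m|)).
  by rewrite ler_wpM2l // (le_trans Zm) // ler_norm.
rewrite mulrAC ler_pdivrMr ?exprn_gt0 //.
apply: (@le_trans _ _ (eps / 2 * L)).
  by rewrite /L mulrDr mulr1 mulrCA divff ?gt_eqF // mulr1 lerDr ltW.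
by rewrite ler_pM2l // expr2 ler_peMl // ltW.
Qed.

Lemma cvg_trig_poly (R : realType) (n : nat)
    (disp : measure_display) (T : measurableType disp) (Pr : probability T R)
    (Z : nat -> T -> 'rV[R]_n) (disp' : measure_display)
    (T' : measurableType disp') (Q : probability T' R) (Y : T' -> 'rV[R]_n)
    (mZ : forall K, random_vector (Z K)) (mY : random_vector Y)
    (cosZ : forall (u : 'rV[R]_n) b,
      \int[Pr]_w cos (\sum_i u 0 i * Z K w 0 i + b) @[K --> \oo] -->
      \int[Q]_w cos (\sum_i u 0 i * Y w 0 i + b)) (p : 'rV[R]_n -> R) :
  trig_poly p -> \int[Pr]_w p (Z K w) @[K --> \oo] --> \int[Q]_w p (Y w).
Proof.
elim=> {p} [//|p q tp cp tq cq|a p tp cp].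
- rewrite RintegralD ?integrable_trig_poly //.
  under eq_fun do rewrite RintegralD ?integrable_trig_poly //.
  exact: cvgD.
- rewrite RintegralZl ?integrable_trig_poly //.
  under eq_fun do rewrite RintegralZl ?integrable_trig_poly //.
  by apply: cvgM => //; exact: cvg_cst.
Qed.

Lemma cvg_bounded_continuous (R : realType) (n : nat)
    (disp : measure_display) (T : measurableType disp) (Pr : probability T R)
    (Z : nat -> T -> 'rV[R]_n) (disp' : measure_display)
    (T' : measurableType disp') (Q : probability T' R) (Y : T' -> 'rV[R]_n)
    (mZ : forall K, random_vector (Z K)) (mY : random_vector Y)
    (iZ : forall K, Pr.-integrable [set: T] (EFin \o (fun w => square_norm (Z K w))))
    (iY : Q.-integrable [set: T'] (EFin \o (fun w => square_norm (Y w))))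
    (m : R) (Zm : forall K, \int[Pr]_w square_norm (Z K w) <= m)
    (cosZ : forall (u : 'rV[R]_n) b,
      \int[Pr]_w cos (\sum_i u 0 i * Z K w 0 i + b) @[K --> \oo] -->
      \int[Q]_w cos (\sum_i u 0 i * Y w 0 i + b)) (f : 'rV[R]_n -> R) (C : R) :
  continuous f -> (forall x, `|f x| <= C) ->
  \int[Pr]_w f (Z K w) @[K --> \oo] --> \int[Q]_w f (Y w).
Proof.
move=> fcont fC; apply/cvgrPdist_le => /= e e0.
have e3 : 0 < e / 3 by rewrite divr_gt0.
(* A second-moment bound common to all [Z K] and to [Y], so that the same [p] applies to each. *)
pose M := Num.max m (\int[Q]_w square_norm (Y w)).
have [p tp pf] := trig_poly_dense M fcont fC e3.
have := cvg_trig_poly mZ mY cosZ tp => /cvgrPdist_le /(_ _ e3).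
apply: filterS => K ZY.
have h1 : `|\int[Pr]_w f (Z K w) - \int[Pr]_w p (Z K w)| <= e / 3.
  by apply: pf => //; apply: le_trans (Zm K) _; rewrite le_max lexx.
have h2 : `|\int[Q]_w f (Y w) - \int[Q]_w p (Y w)| <= e / 3.
  by apply: pf => //; rewrite le_max lexx orbT.
move: h1 h2 ZY; rewrite !ler_norml; lra.
Qed.

(** The convergence theorem applied to a constant sequence in dimension one: its limit is unique. *)
Lemma Rintegral_continuous_eq (R : realType)
    (disp : measure_display) (T : measurableType disp) (Pr : probability T R)
    (X : T -> R) (disp' : measure_display) (T' : measurableType disp')
    (Q : probability T' R) (Y : T' -> R)
    (mX : measurable_fun [set: T] X) (mY : measurable_fun [set: T'] Y)
    (iX : Pr.-integrable [set: T] (EFin \o (fun w => X w ^+ 2)))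
    (iY : Q.-integrable [set: T'] (EFin \o (fun w => Y w ^+ 2)))
    (cosXY : forall t b,
      \int[Pr]_w cos (t * X w + b) = \int[Q]_w cos (t * Y w + b))
    (f : R -> R) (C : R) : continuous f -> (forall x, `|f x| <= C) ->
  \int[Pr]_w f (X w) = \int[Q]_w f (Y w).
Proof.
move=> fcont fC.
pose Z (w : T) : 'rV[R]_1 := const_mx (X w).
pose Z' (w : T') : 'rV[R]_1 := const_mx (Y w).
have sqZ (S : Type) (V : S -> R) :
    (fun w => square_norm (const_mx (V w) : 'rV[R]_1)) = (fun w => V w ^+ 2).
  by apply/funext => w; rewrite /square_norm big_ord1 mxE.
have fE (S : Type) (V : S -> R) (w : S) : f (V w) = f ((const_mx (V w) : 'rV[R]_1) 0 0).
  by rewrite mxE.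
have fc : continuous (fun x : 'rV[R]_1 => f (x 0 0)).
  move=> x; apply: (continuous_comp (f := fun x : 'rV[R]_1 => x 0 0)).
    exact: coord_continuous.
  exact: fcont.
have := @cvg_bounded_continuous R 1 _ T Pr (fun=> Z) _ T' Q Z' _ _ _ _
  (\int[Pr]_w X w ^+ 2) _ _ _ C fc (fun x => fC _).
rewrite /Z /Z' !sqZ => h.
under eq_Rintegral do rewrite fE.
under [in RHS]eq_Rintegral do rewrite fE.
apply/esym; apply: (cvg_unique _ (h _ _ _ _ _ _)); last exact: cvg_cst.
- exact: norm_hausdorff.
- by move=> _ i; under eq_fun do rewrite mxE.
- by move=> i; under eq_fun do rewrite mxE.
- by [].
- by [].
- by [].
move=> u b; set lQ := (X in _ --> X); set lP := (X in (fun _ => X) @ _ --> _).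
have cosE (S : Type) (V : S -> R) (w : S) :
    \sum_(i < 1) u 0 i * (const_mx (V w) : 'rV[R]_1) 0 i = u 0 0 * V w.
  by rewrite big_ord1 mxE.
suff -> : lQ = lP by exact: cvg_cst.
rewrite /lQ /lP; under eq_Rintegral do rewrite cosE.
by under [in RHS]eq_Rintegral do rewrite cosE.
Qed.

(** Continuous approximation from below of the indicator of []-oo, a[], of slope [- N] left of [a]
    and zero from [a] on; such open rays generate the Borel sets. *)
Definition ray_ramp (R : realType) (a : R) (N : nat) (x : R) : R :=
  Num.min 1 (Num.max 0 (N%:R * (a - x))).

Lemma continuous_ray_ramp (R : realType) (a : R) (N : nat) :
  continuous (ray_ramp a N).
Proof.
pose line (x : R) : R^o := N%:R * (a - x).
have line_cont : continuous line.
  move=> x; apply: cvgM; first exact: cvg_cst.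
  by apply: cvgB; [exact: cvg_cst|exact: cvg_id].
suff : continuous ((cst 1 : R -> R^o) \min ((cst 0 : R -> R^o) \max line)) by [].
have cst_cont (c x : R) : {for x, continuous (cst c : R -> R^o)} by exact: cvg_cst.
move=> x; have h := continuous_max (cst_cont 0 x) (line_cont x).
exact: (continuous_min (cst_cont 1 x) h).
Qed.

Lemma ray_ramp_ge0 (R : realType) (a : R) (N : nat) x : 0 <= ray_ramp a N x.
Proof. by rewrite /ray_ramp le_min ler01 le_max lexx. Qed.

Lemma ray_ramp_le1 (R : realType) (a : R) (N : nat) x : `|ray_ramp a N x| <= 1.
Proof. by rewrite ger0_norm ?ray_ramp_ge0 // /ray_ramp ge_min lexx. Qed.

Lemma cvg_ray_ramp (R : realType) (a x : R) :
  ray_ramp a N x @[N --> \oo] --> (\1_(`]-oo, a[%classic) x : R).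
Proof.
rewrite indicE mem_setE in_itv /=; have [xa|ax] := ltP x a; last first.
  under eq_fun do rewrite /ray_ramp (max_l (_ : _ * (a - x) <= 0)) ?mulr_ge0_le0 ?subr_le0 //.
  by rewrite /= (min_r ler01); exact: cvg_cst.
apply/cvgrPdist_le => e e0; exists (Num.truncn (a - x)^-1).+1 => // N /= NN.
have Nax : 1 <= N%:R * (a - x).
  rewrite -ler_pdivrMr ?subr_gt0 // mul1r ltW // (lt_le_trans (truncnS_gt _)) //.
  by rewrite ler_nat.
by rewrite /ray_ramp max_r ?(le_trans ler01) // min_l // subrr normr0 ltW.
Qed.

Lemma cvg_Rintegral_ray_ramp (R : realType) (disp : measure_display)
    (T : measurableType disp) (Pr : probability T R) (X : T -> R) (a : R)
    (mX : measurable_fun [set: T] X) :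
  \int[Pr]_w ray_ramp a N (X w) @[N --> \oo] -->
  fine (Pr (X @^-1` `]-oo, a[%classic)).
Proof.
have mA : measurable (X @^-1` `]-oo, a[%classic).
  by rewrite -[_ @^-1` _]setTI; apply: mX.
have mf N : measurable_fun [set: T] (fun w => ray_ramp a N (X w)).
  apply: (measurableT_comp (f := ray_ramp a N)) => //.
  by apply: continuous_measurable_fun; exact: continuous_ray_ramp.
have [|||||_ _] := @dominated_convergence _ T R Pr [set: T] measurableT
  (fun N w => (ray_ramp a N (X w))%:E) (fun w => (\1_(X @^-1` `]-oo, a[%classic) w)%:E)
  (cst 1%:E) _ _ _ _ _.
- by move=> N; apply/measurable_EFinP; exact: mf.
- by apply/measurable_EFinP; exact: measurable_indic.
- apply: aeW => w _; apply: cvg_EFin; first exact: nearW.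
  exact: cvg_ray_ramp.
- by apply: (@bounded_integrable _ _ _ _ (cst 1) 1) => // w; rewrite normr1.
- by apply: aeW => w N _; rewrite lee_fin ray_ramp_le1.
rewrite integral_indic // setIT => h.
rewrite /Rintegral; apply: fine_cvg; rewrite fineK; [exact: h|exact: fin_num_measure].
Qed.

(** The two laws agree on open rays, by passing to the limit in the ramps, and open rays are stable
    under intersection and generate the Borel sets. *)
Lemma law_eq_of_cos (R : realType)
    (disp : measure_display) (T : measurableType disp) (Pr : probability T R)
    (X : T -> R) (disp' : measure_display) (T' : measurableType disp')
    (Q : probability T' R) (Y : T' -> R)
    (mX : measurable_fun [set: T] X) (mY : measurable_fun [set: T'] Y)
    (iX : Pr.-integrable [set: T] (EFin \o (fun w => X w ^+ 2)))
    (iY : Q.-integrable [set: T'] (EFin \o (fun w => Y w ^+ 2)))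
    (cosXY : forall t b,
      \int[Pr]_w cos (t * X w + b) = \int[Q]_w cos (t * Y w + b))
    (B : set R) : measurable B -> Pr (X @^-1` B) = Q (Y @^-1` B).
Proof.
pose X' : {mfun T >-> R} := HB.pack X (isMeasurableFun.Build _ _ _ _ X mX).
pose Y' : {mfun T' >-> R} := HB.pack Y (isMeasurableFun.Build _ _ _ _ Y mY).
apply: (@measure_unique _ _ _ (@RGenInftyO.G R) (fun n => `]-oo, n%:R[%classic)
  _ _ _ _ (distribution Pr X') (distribution Q Y')).
- exact: RGenInftyO.measurableE.
- move=> _ _ [x ->] [y ->]; exists (Num.min x y).
  by apply/seteqP; split => z /=; rewrite !in_itv /= lt_min => /andP.
- by move=> n; exists n%:R.
- apply/seteqP; split => // x _; exists (Num.truncn x).+1 => //=.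
  by rewrite in_itv /= truncnS_gt.
- move=> _ [a ->]; rewrite /distribution /pushforward /=.
  suff : fine (Pr (X @^-1` `]-oo, a[%classic)) = fine (Q (Y @^-1` `]-oo, a[%classic)).
    have mpre d' (S : measurableType d') (V : S -> R) : measurable_fun [set: S] V ->
        measurable (V @^-1` `]-oo, a[%classic).
      by move=> mV; rewrite -[_ @^-1` _]setTI; exact: mV.
    move=> h; rewrite -[LHS]fineK; last by apply: fin_num_measure; exact: mpre.
    by rewrite [fine _]h fineK //; apply: fin_num_measure; exact: mpre.
  have h1 := @cvg_Rintegral_ray_ramp _ _ _ Pr _ a mX.
  have h2 := @cvg_Rintegral_ray_ramp _ _ _ Q _ a mY.
  have E N : \int[Pr]_w ray_ramp a N (X w) = \int[Q]_w ray_ramp a N (Y w).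
    exact: (Rintegral_continuous_eq mX mY iX iY cosXY
      (@continuous_ray_ramp R a N) (@ray_ramp_le1 R a N)).
  rewrite (funext E) in h1.
  by apply: (cvg_unique _ h1 h2); exact: norm_hausdorff.
- by move=> k; rewrite ltey_eq fin_num_measure.
Qed.

(** * The normal law *)

(** The integral over [[- n.+1, n.+1]] is a boundary term of order [1 / n.+1], so decay of [F] is
    required at integers only. It provides the integration by parts on the line behind Stein's
    identity. *)
Lemma integral_derive_eq0 (R : realType) (f F : R -> R) (K : R)
    (fcont : continuous f) (dF : forall x, is_derive x (1 : R) F (f x))
    (fint : lebesgue_measure.-integrable [set: R] (EFin \o f))
    (Fbound : forall n : nat, `|F n.+1%:R| <= K / n.+1%:R /\ `|F (- n.+1%:R)| <= K / n.+1%:R) :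
  \int[lebesgue_measure]_x f x = 0.
Proof.
have mf : measurable_fun [set: R] f by exact: continuous_measurable_fun.
have K0 : 0 <= K.
  have := le_trans (normr_ge0 _) (Fbound 0%N).1.
  by rewrite divr1.
pose I n : set R := `[- n.+1%:R, n.+1%:R]%classic.
have FTC n : (\int[lebesgue_measure]_(x in I n) (f x)%:E = (F n.+1%:R - F (- n.+1%:R))%:E)%E.
  rewrite EFinB; apply: continuous_FTC2.
  - by rewrite (@lt_trans _ _ 0) ?oppr_lt0 ?ltr0n.
  - exact: continuous_subspaceT.
  - have dF1 x : derivable F x (1 : R) by exact: ex_derive.
    have cF x : {for x, continuous F}.
      by apply: differentiable_continuous; apply/derivable1_diffP.
    split; first by move=> x _; exact: dF1.
      by apply: cvg_at_right_filter; exact: cF.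
    by apply: cvg_at_left_filter; exact: cF.
  - by move=> x _; rewrite derive1E; exact: derive_val.
have [|||||_ _] := @dominated_convergence _ _ R lebesgue_measure [set: R] measurableT
  (fun n => (EFin \o f) \_ (I n)) (EFin \o f) (fun x => `|f x|%:E) _ _ _ _ _.
- move=> n; have mI : measurable (I n) by exact: measurable_itv.
  apply/(measurable_restrictT _ mI)/measurable_EFinP.
  exact: measurable_funTS.
- exact/measurable_EFinP.
- apply: aeW => x _; apply: cvg_near_cst.
  exists (Num.truncn `|x|) => // n /= xn; rewrite /restrict mem_set //=.
  rewrite /I /= in_itv /= -ler_norml ltW // (lt_le_trans (truncnS_gt _)) //.
  by rewrite ler_nat ltnS.
- exact: integrable_norm fint.
- apply: aeW => x n _; rewrite /restrict; case: ifP => _ //=.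
  by rewrite normr0 lee_fin.
have E : (fun n => \int[lebesgue_measure]_x ((EFin \o f) \_ (I n)) x)%E =
    (fun n => (F n.+1%:R - F (- n.+1%:R))%:E).
  by apply/funext => n; rewrite -integral_mkcond FTC.
rewrite E => h.
have F0 : (F n.+1%:R - F (- n.+1%:R)) @[n --> \oo] --> (0 : R).
  apply/cvgr0Pnorm_le => e e0; exists (Num.truncn (2 * K / e)) => // n /= Kn.
  have : 2 * K / e <= n.+1%:R.
    apply: ltW; apply: lt_le_trans (truncnS_gt _) _.
    by rewrite ler_nat ltnS.
  rewrite ler_pdivrMr // => Kne.
  have n0 : 0 < n.+1%:R :> R by rewrite ltr0n.
  apply: (@le_trans _ _ (2 * K / n.+1%:R)); last first.
    by rewrite ler_pdivrMr // [e * _]mulrC.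
  apply: le_trans (ler_normB _ _) _; have [] := Fbound n.
  have -> : 2 * K / n.+1%:R = K / n.+1%:R + K / n.+1%:R by ring.
  exact: lerD.
have E0 := cvg_unique _ h (cvg_EFin _ F0).
rewrite /Rintegral (_ : (\int[lebesgue_measure]_x _)%E = 0%E) //.
apply: E0; first exact: ereal_hausdorff.
by apply: nearW.
Qed.

(** [normal_pdf] and the Radon-Nikodym derivative have the same integral over every measurable set,
    hence agree almost everywhere. *)
Lemma ge0_integral_normal_prob (R : realType) (m s : R) (f : R -> \bar R) :
  measurable_fun [set: R] f -> (forall x, 0 <= f x)%E ->
  (\int[normal_prob m s]_x f x =
   \int[lebesgue_measure]_x (f x * (normal_pdf m s x)%:E))%E.
Proof.
move=> mf f0.
have dom := normal_prob_dominates m s.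
have mpdf : measurable_fun [set: R] (fun x => (normal_pdf m s x)%:E).
  by apply/measurable_EFinP; exact: measurable_normal_pdf.
rewrite -(Radon_Nikodym_SigmaFinite.change_of_variables dom f0 measurableT mf).
have mRN := measurable_int _ (Radon_Nikodym_SigmaFinite.f_integrable dom).
apply: ae_eq_integral => //.
- exact: emeasurable_funM.
- exact: emeasurable_funM.
have RN : ae_eq lebesgue_measure [set: R]
    (Radon_Nikodym_SigmaFinite.f (normal_prob m s) lebesgue_measure)
    (fun x => (normal_pdf m s x)%:E).
  apply: integral_ae_eq => //; first exact: Radon_Nikodym_SigmaFinite.f_integrable.
  by move=> A _ mA; rewrite -Radon_Nikodym_SigmaFinite.f_integral.
by apply: filterS RN => x RN Tx; rewrite RN.
Qed.

(** A quadratic factor is paid for by doubling the variance: with [y = x^2 / (4 s^2)], one factor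
    [expR (- y)] absorbs [1 + y]. Integrability of moments then reduces to that of a density. *)
Lemma normal_fun_tail (R : realType) (s x : R) : s != 0 ->
  (1 + x ^+ 2) * normal_fun 0 s x <= (1 + 4 * s ^+ 2) * normal_fun 0 (Num.sqrt 2 * s) x.
Proof.
move=> s0; rewrite /normal_fun subr0.
have s2 : 0 < s ^+ 2 by rewrite exprn_even_gt0.
have r2 : (Num.sqrt 2 * s) ^+ 2 = 2 * s ^+ 2 by rewrite exprMn sqr_sqrtr.
rewrite r2; set y := x ^+ 2 / (4 * s ^+ 2).
have y0 : 0 <= y by rewrite divr_ge0 ?sqr_ge0 // mulr_ge0 // ltW.
have -> : - x ^+ 2 / (s ^+ 2 *+ 2) = - y - y.
  by rewrite /y; field.
have -> : - x ^+ 2 / ((2 * s ^+ 2) *+ 2) = - y.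
  by rewrite /y; field.
rewrite expRD mulrA ler_pM2r ?expR_gt0 // expRN ler_pdivrMr ?expR_gt0 //.
apply: (@le_trans _ _ ((1 + 4 * s ^+ 2) * (1 + y))).
  have -> : x ^+ 2 = 4 * s ^+ 2 * y by rewrite /y; field.
  nra.
by rewrite ler_wpM2l ?expR_ge1Dx //; lra.
Qed.

Lemma normal_pdf_tail (R : realType) (s : R) : s != 0 ->
  exists2 K : R, 0 <= K & forall x,
    (1 + x ^+ 2) * normal_pdf 0 s x <= K * normal_pdf 0 (Num.sqrt 2 * s) x.
Proof.
move=> s0; have r0 : Num.sqrt 2 * s != 0 by rewrite mulf_neq0 // gt_eqF // sqrtr_gt0.
have p1 := normal_peak_gt0 s0; have p2 := normal_peak_gt0 r0.
exists ((1 + 4 * s ^+ 2) * normal_peak s / normal_peak (Num.sqrt 2 * s)).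
  by rewrite divr_ge0 ?(ltW p2) // mulr_ge0 ?(ltW p1) //; have := sqr_ge0 s; lra.
move=> x; rewrite !normal_pdfE //; have := normal_fun_tail x s0.
move: p1 p2; set p := normal_peak s; set q := normal_peak _; move=> p1 p2 FG.
rewrite [leLHS]mulrCA.
have -> : (1 + 4 * s ^+ 2) * p / q * (q * normal_fun 0 (Num.sqrt 2 * s) x) =
    p * ((1 + 4 * s ^+ 2) * normal_fun 0 (Num.sqrt 2 * s) x).
  by field; rewrite gt_eqF.
by rewrite ler_pM2l.
Qed.

Lemma integrable_mul_normal_pdf (R : realType) (s : R) (f : R -> R) (C : R) :
  s != 0 -> measurable_fun [set: R] f -> (forall x, `|f x| <= C * (1 + x ^+ 2)) ->
  lebesgue_measure.-integrable [set: R] (EFin \o (fun x => f x * normal_pdf 0 s x)).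
Proof.
move=> s0 mf fC; have [K K0 pK] := normal_pdf_tail s0.
have C0 : 0 <= C by have := le_trans (normr_ge0 _) (fC 0); rewrite expr0n /= addr0 mulr1.
apply: (@le_integrable _ _ R lebesgue_measure [set: R] measurableT
  (EFin \o (fun x => f x * normal_pdf 0 s x))
  (fun x => (C * K)%:E * (normal_pdf 0 (Num.sqrt 2 * s) x)%:E)%E).
- apply/measurable_EFinP; apply: measurable_funM => //; exact: measurable_normal_pdf.
- move=> x _ /=; rewrite lee_fin normrM (ger0_norm (normal_pdf_ge0 _ _ _)).
  rewrite [leRHS]ger0_norm; last by rewrite !mulr_ge0 // normal_pdf_ge0.
  apply: (@le_trans _ _ (C * ((1 + x ^+ 2) * normal_pdf 0 s x))).
    by rewrite mulrA ler_wpM2r // normal_pdf_ge0.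
  by rewrite -mulrA ler_wpM2l.
- by apply: integrableZl => //; exact: integrable_normal_pdf.
Qed.

Lemma integrable_normal_prob (R : realType) (s : R) (f : R -> R) (C : R) :
  s != 0 -> measurable_fun [set: R] f -> (forall x, `|f x| <= C * (1 + x ^+ 2)) ->
  (normal_prob 0 s).-integrable [set: R] (EFin \o f).
Proof.
move=> s0 mf fC; apply/integrableP; split; first exact/measurable_EFinP.
rewrite ge0_integral_normal_prob //; last first.
  by apply: measurableT_comp => //; exact/measurable_EFinP.
have /integrableP[_] := integrable_mul_normal_pdf s0 mf fC.
congr (_ < _)%E; apply: eq_integral => x _ /=.
by rewrite normrM (ger0_norm (normal_pdf_ge0 _ _ _)).
Qed.

Lemma Rintegral_normal_prob (R : realType) (s : R) (f : R -> R) (C : R) :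
  s != 0 -> measurable_fun [set: R] f -> (forall x, `|f x| <= C * (1 + x ^+ 2)) ->
  \int[normal_prob 0 s]_x f x = \int[lebesgue_measure]_x (f x * normal_pdf 0 s x).
Proof.
move=> s0 mf fC; congr fine.
have mfE : measurable_fun [set: R] (EFin \o f) by exact/measurable_EFinP.
rewrite integralE [RHS]integralE; congr (_ - _)%E.
  rewrite ge0_integral_normal_prob //; last exact: measurable_funepos.
  apply: eq_integral => x _; have p0 := normal_pdf_ge0 0 s x.
  rewrite !funeposE /= -!EFin_max -EFinM maxr_pMl // mul0r.
  by [].
rewrite ge0_integral_normal_prob //; last exact: measurable_funeneg.
apply: eq_integral => x _; have p0 := normal_pdf_ge0 0 s x.
by rewrite !funenegE /= -!EFin_max -EFinM maxr_pMl // mul0r mulNr.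
Qed.

Lemma Rintegral_probability_cst (R : realType) (disp : measure_display)
    (T : measurableType disp) (Pr : probability T R) (c : R) :
  \int[Pr]__ c = c.
Proof.
rewrite Rintegral_cst //; have -> : fine (Pr [set: T]) = 1 by rewrite probability_setT.
by rewrite mulr1.
Qed.

Lemma is_derive_normal_pdf (R : realType) (s x : R) : s != 0 ->
  is_derive x (1 : R) (normal_pdf 0 s) (- (x / s ^+ 2) * normal_pdf 0 s x).
Proof.
move=> s0; rewrite !normal_pdfE //.
pose q (y : R) := - (y - 0) ^+ 2 / (s ^+ 2 *+ 2).
have dq : is_derive x (1 : R) q (- (x / s ^+ 2)).
  by apply: is_derive_eq; rewrite /GRing.scale /=; field.
have de := is_derive1_comp (is_derive_expR (q x)) dq.
apply: (@is_derive_eq _ _ _ (fun y => normal_peak s * (expR \o q) y)).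
by rewrite /normal_fun /= -/(q x) /GRing.scale /=; ring.
Qed.

Lemma normal_pdf_decay (R : realType) (s : R) : s != 0 ->
  exists2 K : R, 0 <= K & forall x, (1 + x ^+ 2) * normal_pdf 0 s x <= K.
Proof.
move=> s0; have r0 : Num.sqrt 2 * s != 0 by rewrite mulf_neq0 // gt_eqF // sqrtr_gt0.
have [K K0 pK] := normal_pdf_tail s0.
exists (K * normal_peak (Num.sqrt 2 * s)) => [|x].
  by rewrite mulr_ge0 // normal_peak_ge0.
by apply: le_trans (pK x) _; rewrite ler_wpM2l // normal_pdf_ub.
Qed.

(** Stein's identity: [s^2 g' - x g] times the density is the derivative of [s^2 g] times the
    density. The choices [1], [id] and a sine for [g] give the mean, the variance and the cosine
    transform. *)
Lemma normal_prob_stein (R : realType) (s : R) (g g' : R -> R) (C : R) :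
  s != 0 -> (forall x, is_derive x (1 : R) g (g' x)) -> continuous g' ->
  (forall x, `|g x| <= C * (1 + `|x|)) -> (forall x, `|g' x| <= C) ->
  \int[normal_prob 0 s]_x (x * g x) = s ^+ 2 * \int[normal_prob 0 s]_x g' x.
Proof.
move=> s0 dg cg' gC g'C.
have C0 : 0 <= C by exact: le_trans (normr_ge0 _) (g'C 0).
have s20 : 0 < s ^+ 2 by rewrite exprn_even_gt0.
have cg : continuous g.
  move=> x; apply: differentiable_continuous; apply/derivable1_diffP.
  exact: ex_derive.
have mg : measurable_fun [set: R] g by exact: continuous_measurable_fun.
have mg' : measurable_fun [set: R] g' by exact: continuous_measurable_fun.
have mxg : measurable_fun [set: R] (fun x => x * g x) by exact: measurable_funM.
have bxg x : `|x * g x| <= 2 * C * (1 + x ^+ 2).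
  rewrite normrM -(real_normK (num_real x)).
  have x0 := normr_ge0 x; have := gC x; set y := `|x| in x0 *.
  move=> gy; apply: (@le_trans _ _ (y * (C * (1 + y)))); first by rewrite ler_wpM2l.
  have -> : y * (C * (1 + y)) = C * (y + y ^+ 2) by ring.
  have -> : 2 * C * (1 + y ^+ 2) = C * (2 * (1 + y ^+ 2)) by ring.
  by rewrite ler_wpM2l //; have := sqr_ge0 (y - 1); nra.
have bg' x : `|g' x| <= C * (1 + x ^+ 2).
  by apply: le_trans (g'C x) _; rewrite ler_peMr // lerDl sqr_ge0.
pose f x := (s ^+ 2 * g' x - x * g x).
have mf : measurable_fun [set: R] f.
  by apply: measurable_funB => //; exact: measurable_funM.
have bf x : `|f x| <= (s ^+ 2 * C + 2 * C) * (1 + x ^+ 2).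
  apply: le_trans (ler_normB _ _) _; rewrite mulrDl lerD //.
  by rewrite -mulrA; apply: normM_le => //; rewrite ger0_norm // ltW.
have ixg := integrable_normal_prob s0 mxg bxg.
have ig' := integrable_normal_prob s0 mg' bg'.
suff : \int[normal_prob 0 s]_x f x = 0.
  rewrite /f RintegralB //; last exact: (integrableZl measurableT (s ^+ 2) ig').
  by rewrite RintegralZl // => /eqP; rewrite subr_eq0 => /eqP.
rewrite (Rintegral_normal_prob s0 mf bf).
have [K K0 pK] := normal_pdf_decay s0.
apply: (@integral_derive_eq0 _ _ (fun x => s ^+ 2 * (g x * normal_pdf 0 s x))
  (s ^+ 2 * (2 * C * K))).
- move=> x; apply: cvgM; last exact: continuous_normal_pdf.
  apply: cvgB; first by apply: cvgM; [exact: cvg_cst|exact: cg'].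
  by apply: cvgM; [exact: cvg_id|exact: cg].
- move=> x; have dpdf := is_derive_normal_pdf x s0; have dgx := dg x.
  apply: (@is_derive_eq _ _ _ (fun x => s ^+ 2 * (g x * normal_pdf 0 s x))).
  by rewrite /f /GRing.scale /=; field.
- exact: integrable_mul_normal_pdf mf bf.
move=> n.
suff bnd x : `|x| = n.+1%:R ->
    `|s ^+ 2 * (g x * normal_pdf 0 s x)| <= s ^+ 2 * (2 * C * K) / n.+1%:R.
  by split; apply: bnd; rewrite ?normrN ger0_norm.
move=> xn; rewrite normrM gtr0_norm // -mulrA ler_pM2l // normrM.
rewrite (ger0_norm (normal_pdf_ge0 _ _ _)) ler_pdivlMr ?ltr0n //.
have := pK x; have := gC x; rewrite -(real_normK (num_real x)) xn.
have p0 := normal_pdf_ge0 0 s x; set p := normal_pdf 0 s x in p0 *.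
have : 1 <= n.+1%:R :> R by rewrite ler1n.
set N : R := n.+1%:R => N1 gN pN.
apply: (@le_trans _ _ (C * (1 + N) * p * N)).
  by rewrite ler_wpM2r ?ler_wpM2r //; lra.
have -> : C * (1 + N) * p * N = C * ((1 + N) * N * p) by ring.
have -> : 2 * C * K = C * (2 * K) by ring.
rewrite ler_wpM2l //.
apply: (@le_trans _ _ (2 * ((1 + N ^+ 2) * p))); last by rewrite ler_pM2l.
rewrite mulrA ler_wpM2r //; nra.
Qed.

Lemma normal_prob_mean (R : realType) (s : R) : s != 0 ->
  \int[normal_prob 0 s]_x x = 0.
Proof.
move=> s0; transitivity (\int[normal_prob 0 s]_x (x * 1)).
  by apply: eq_Rintegral => x _; rewrite mulr1.
rewrite (@normal_prob_stein R s (fun=> 1) (fun=> 0) 1 s0).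
- by rewrite Rintegral_probability_cst mulr0.
- by move=> x; exact: cvg_cst.
- by move=> x; rewrite normr1 mul1r lerDl.
- by move=> x; rewrite normr0.
Qed.

Lemma normal_prob_sqr (R : realType) (s : R) : s != 0 ->
  \int[normal_prob 0 s]_x (x ^+ 2) = s ^+ 2.
Proof.
move=> s0; transitivity (\int[normal_prob 0 s]_x (x * x)).
  by apply: eq_Rintegral => x _; rewrite expr2.
rewrite (@normal_prob_stein R s id (fun=> 1) 1 s0).
- by rewrite Rintegral_probability_cst mulr1.
- by move=> x; exact: cvg_cst.
- by move=> x; rewrite mul1r lerDr.
- by move=> x; rewrite normr1.
Qed.

(** Stands in for differentiation under the integral sign: a quadratic remainder can be integrated
    directly. *)
Lemma is_derive_of_quadratic (R : realType) (phi : R -> R) (t l K : R) :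
  (forall h, `|phi (t + h) - phi t - h * l| <= K * h ^+ 2) ->
  is_derive t (1 : R) phi l.
Proof.
move=> phiK.
have K0 : 0 <= K by have := le_trans (normr_ge0 _) (phiK 1); rewrite expr1n mulr1.
have H : (h^-1 *: (phi (h *: (1 : R) + t) - phi t)) @[h --> 0^'] --> l.
  apply/cvgrPdist_le => e e0.
  have K1 : 0 < K + 1 by rewrite ltr_wpDl.
  near=> h.
  have h0 : h != 0 by near: h; exact: nbhs_dnbhs_neq.
  have hn : 0 < `|h| by rewrite normr_gt0.
  have -> : l - h^-1 *: (phi (h *: (1 : R) + t) - phi t) =
     - (phi (t + h) - phi t - h * l) / h.
    rewrite /GRing.scale /= mulr1 [h + t]addrC; by field.
  rewrite normrM normrN normfV ler_pdivrMr //; apply: le_trans (phiK h) _.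
  rewrite -(real_normK (num_real h)) expr2 mulrA ler_pM2r //.
  have : `|h| < e / (K + 1).
    near: h; apply: dnbhs0_lt; exact: divr_gt0.
  by rewrite ltr_pdivlMr //; nra.
by apply: DeriveDef; [apply/cvg_ex; exists l|exact: cvg_lim].
Unshelve. all: by end_near. Qed.

Lemma continuous_cos_line (R : realType) (t b : R) :
  continuous (fun x : R => cos (t * x + b)).
Proof.
move=> x; apply: (continuous_comp (f := fun x => t * x + b)); last exact: continuous_cos.
by apply: cvgD; [apply: cvgM; [exact: cvg_cst|exact: cvg_id]|exact: cvg_cst].
Qed.

Lemma continuous_sin_line (R : realType) (t b : R) :
  continuous (fun x : R => sin (t * x + b)).
Proof.
move=> x; apply: (continuous_comp (f := fun x => t * x + b)); last exact: continuous_sin.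
by apply: cvgD; [apply: cvgM; [exact: cvg_cst|exact: cvg_id]|exact: cvg_cst].
Qed.

(* As a function of [t] the integral phi solves phi' = - s^2 t phi. *)
Lemma normal_prob_cos (R : realType) (s t b : R) : s != 0 ->
  \int[normal_prob 0 s]_x cos (t * x + b) = expR (- (s ^+ 2 * t ^+ 2 / 2)) * cos b.
Proof.
move=> s0; pose phi t := \int[normal_prob 0 s]_x cos (t * x + b).
have s20 : 0 < s ^+ 2 by rewrite exprn_even_gt0.
have mcos r : measurable_fun [set: R] (fun x => cos (r * x + b)).
  by apply: continuous_measurable_fun; exact: continuous_cos_line.
have msin r : measurable_fun [set: R] (fun x => x * sin (r * x + b)).
  apply: measurable_funM => //.
  by apply: continuous_measurable_fun; exact: continuous_sin_line.
have one (x : R) : 1 <= 1 + x ^+ 2 by rewrite lerDl sqr_ge0.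
have icos r : (normal_prob 0 s).-integrable [set: R] (EFin \o (fun x => cos (r * x + b))).
  apply: (@integrable_normal_prob _ _ _ 1) => // x.
  by rewrite mul1r (le_trans (norm_cos_le1 _)).
have isin r : (normal_prob 0 s).-integrable [set: R] (EFin \o (fun x => x * sin (r * x + b))).
  apply: (@integrable_normal_prob _ _ _ 1) => // x; rewrite mul1r normrM.
  apply: (@le_trans _ _ `|x|); first by rewrite ler_piMr // norm_sin_le1.
  by rewrite -(real_normK (num_real x)); have := sqr_ge0 (`|x| - 1); nra.
have isq : (normal_prob 0 s).-integrable [set: R] (EFin \o (fun x => x ^+ 2)).
  apply: (@integrable_normal_prob _ _ _ 1) => // x.
  by rewrite mul1r ger0_norm ?sqr_ge0 // lerDr.
(* The integral on the left is, up to sign, the formal derivative of [phi]; Stein's identity with a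
   sine as [g] returns it to [phi]. *)
have stein r : \int[normal_prob 0 s]_x (x * sin (r * x + b)) = s ^+ 2 * (r * phi r).
  rewrite /phi -RintegralZl //.
  apply: (@normal_prob_stein _ _ _ _ (1 + `|r|)) => //.
  - move=> x; have dl : is_derive x (1 : R) (fun x => r * x + b) r.
      by apply: is_derive_eq; rewrite /GRing.scale /=; ring.
    apply: is_derive_eq (is_derive1_comp (is_derive_sin _) dl) _.
    by rewrite /GRing.scale /= mulrC.
  - by move=> x; apply: cvgM; [exact: cvg_cst|exact: continuous_cos_line].
  - move=> x; apply: le_trans (norm_sin_le1 _) _; have := normr_ge0 x; have := normr_ge0 r; nra.
  - move=> x; rewrite normrM; have := norm_cos_le1 (r * x + b); have := normr_ge0 r; nra.
have dphi r : is_derive r (1 : R) phi (- (s ^+ 2 * (r * phi r))).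
  (* The remainder [3 (h x)^2] of [norm_cos_taylor1], integrated with [normal_prob_sqr], gives
     [3 s^2 h^2]. *)
  apply: (@is_derive_of_quadratic _ _ _ _ (3 * s ^+ 2)) => h.
  have iB : (normal_prob 0 s).-integrable [set: R] (EFin \o
      (fun x => cos ((r + h) * x + b) - cos (r * x + b))).
    exact: (integrableB measurableT (icos (r + h)) (icos r)).
  have iZ : (normal_prob 0 s).-integrable [set: R] (EFin \o
      (fun x => h * (x * sin (r * x + b)))).
    exact: (integrableZl measurableT h (isin r)).
  have i1 : (normal_prob 0 s).-integrable [set: R] (EFin \o
      (fun x => cos ((r + h) * x + b) - cos (r * x + b) + h * (x * sin (r * x + b)))).
    exact: (integrableD measurableT iB iZ).
  have -> : phi (r + h) - phi r - h * - (s ^+ 2 * (r * phi r)) =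
      \int[normal_prob 0 s]_x
        (cos ((r + h) * x + b) - cos (r * x + b) + h * (x * sin (r * x + b))).
    rewrite RintegralD // RintegralB // RintegralZl // stein -/(phi _) -/(phi _).
    by ring.
  have -> : 3 * s ^+ 2 * h ^+ 2 = \int[normal_prob 0 s]_x (3 * h ^+ 2 * x ^+ 2).
    by rewrite RintegralZl // normal_prob_sqr //; ring.
  apply: le_trans (le_normr_Rintegral _ i1) _ => //.
  apply: le_Rintegral => //.
  - exact: integrable_norm i1.
  - exact: (integrableZl measurableT (3 * h ^+ 2) isq).
  move=> x _; have := norm_cos_taylor1 (r * x + b) (h * x).
  have -> : r * x + b + h * x = (r + h) * x + b by ring.
  by rewrite exprMn !mulrA.
pose q (r : R) : R := s ^+ 2 * r ^+ 2 / 2.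
(* Integrating factor: the product is constant, and its value at 0 is [cos b]. *)
have dG r : is_derive r (1 : R) (fun r => phi r * expR (q r)) 0.
  have dq : is_derive r (1 : R) q (s ^+ 2 * r).
    by apply: is_derive_eq; rewrite /GRing.scale /=; field.
  have de := is_derive1_comp (is_derive_expR (q r)) dq.
  have dp := dphi r.
  apply: (@is_derive_eq _ _ _ (fun r => phi r * (expR \o q) r)).
  by rewrite /GRing.scale /=; ring.
have := is_derive_0_is_cst t 0 dG.
rewrite [q 0]/q expr0n /= mulr0 mul0r expR0 mulr1 => E.
rewrite -/(q t).
rewrite -/(phi t) expRN -[phi t]mulr1 -[X in _ * X](@divff _ (expR (q t))) ?gt_eqF ?expR_gt0 //.
rewrite mulrA E mulrC; congr (_ * _).
rewrite /phi; under eq_Rintegral do rewrite mul0r add0r.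
exact: Rintegral_probability_cst.
Qed.

Lemma Rintegral_dirac (R : realType) (a : R) (f : R -> R) :
  measurable_fun [set: R] f -> \int[(\d_(a : measurableTypeR R) : probability (measurableTypeR R) R)]_x f x = f a.
Proof.
move=> mf; rewrite /Rintegral integral_dirac //; last exact/measurable_EFinP.
by rewrite diracT mul1e.
Qed.

(** Covers the point mass and the density case together, so that what follows needs no distinction
    on [s]. *)
Lemma normal_law_probability (R : realType) (s : R) :
  exists P : probability (measurableTypeR R) R,
    [/\ forall B, P B = normal_law 0 s B,
        P.-integrable [set: R] (EFin \o (fun x => x ^+ 2)),
        forall t b, \int[P]_x cos (t * x + b) = expR (- (s ^+ 2 * t ^+ 2 / 2)) * cos b,
        \int[P]_x x = 0 & \int[P]_x (x ^+ 2) = s ^+ 2].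
Proof.
have [->|s0] := eqVneq s 0.
  exists (\d_(0 : measurableTypeR R)); split.
  - by move=> B; rewrite /normal_law eqxx.
  - apply/integrableP; split; first exact/measurable_EFinP.
    rewrite integral_dirac //; first by rewrite diracT mul1e /= ltry.
    by apply: measurableT_comp => //; exact/measurable_EFinP.
  - move=> t b; rewrite (@Rintegral_dirac _ _ (fun x => cos (t * x + b))); last first.
      by apply: continuous_measurable_fun; exact: continuous_cos_line.
    by rewrite expr0n /= !mul0r oppr0 expR0 mul1r mulr0 add0r.
  - by rewrite (@Rintegral_dirac _ _ id).
  - by rewrite (@Rintegral_dirac _ _ (fun x => x ^+ 2)).
exists (normal_prob 0 s); split.
- by move=> B; rewrite /normal_law (negPf s0).
- apply: (@integrable_normal_prob _ _ _ 1) => // x.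
  by rewrite mul1r ger0_norm ?sqr_ge0 // lerDr.
- by move=> t b; exact: normal_prob_cos.
- exact: normal_prob_mean.
- exact: normal_prob_sqr.
Qed.

Lemma Rintegral_law (R : realType) (disp : measure_display)
    (T : measurableType disp) (Pr : probability T R) (X : T -> R)
    (P : probability (measurableTypeR R) R) (f : R -> R) :
  measurable_fun [set: T] X ->
  (forall B, measurable B -> Pr (X @^-1` B) = P B) ->
  measurable_fun [set: R] f ->
  Pr.-integrable [set: T] (EFin \o (fun w => f (X w))) ->
  \int[Pr]_w f (X w) = \int[P]_x f x.
Proof.
move=> mX law mf iX; congr fine.
pose X' : {mfun T >-> measurableTypeR R} :=
  HB.pack X (isMeasurableFun.Build _ _ T (measurableTypeR R) X mX).
have mfE : measurable_fun [set: R] (EFin \o f) by exact/measurable_EFinP.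
rewrite -(@eq_measure_integral _ _ _ _ P (distribution Pr X')); last first.
  by move=> B mB _; exact: law.
by rewrite integral_distribution.
Qed.

Lemma integrable_of_sqr (R : realType) (disp : measure_display)
    (T : measurableType disp) (Pr : probability T R) (X : T -> R) :
  measurable_fun [set: T] X ->
  Pr.-integrable [set: T] (EFin \o (fun w => X w ^+ 2)) ->
  Pr.-integrable [set: T] (EFin \o X).
Proof.
move=> mX iX.
have i1 : Pr.-integrable [set: T] (EFin \o (cst 1 : T -> R)).
  by apply: (@bounded_integrable _ _ _ _ _ 1) => // w; rewrite normr1.
apply: (@le_integrable _ _ R Pr [set: T] measurableT (EFin \o X)
  (fun w => (1%:E + (X w ^+ 2)%:E)%E)) => //.
- exact/measurable_EFinP.
- move=> w _ /=; rewrite lee_fin [leRHS]ger0_norm ?addr_ge0 ?sqr_ge0 //.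
  by rewrite -(real_normK (num_real (X w))); have := sqr_ge0 (`|X w| - 1); nra.
- exact: (integrableD measurableT i1 iX).
Qed.

(** The cosine transform determines the law, so law, mean and second moment are read off the model
    on the line. *)
Lemma normal_law_of_cos (R : realType) (disp : measure_display)
    (T : measurableType disp) (Pr : probability T R) (X : T -> R) (s : R)
    (mX : measurable_fun [set: T] X)
    (iX : Pr.-integrable [set: T] (EFin \o (fun w => X w ^+ 2)))
    (cosX : forall t b,
      \int[Pr]_w cos (t * X w + b) = expR (- (s ^+ 2 * t ^+ 2 / 2)) * cos b) :
  [/\ forall B, measurable B -> Pr (X @^-1` B) = normal_law 0 s B,
      \int[Pr]_w X w = 0 & \int[Pr]_w (X w ^+ 2) = s ^+ 2].
Proof.
have [P [PE iP cosP meanP sqrP]] := normal_law_probability s.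
have law B : measurable B -> Pr (X @^-1` B) = P B.
  move=> mB; rewrite (@law_eq_of_cos R _ T Pr X _ (measurableTypeR R) P id mX _ iX iP) //.
  by move=> t b; rewrite cosX cosP.
split.
- by move=> B mB; rewrite law.
- rewrite -meanP; apply: (@Rintegral_law _ _ _ _ _ P id) => //.
  exact: integrable_of_sqr.
- by rewrite -sqrP; apply: (@Rintegral_law _ _ _ _ _ P (fun x => x ^+ 2)).
Qed.

(** * Gaussian vectors *)

Lemma integrable_fst (R : realType) (d1 d2 : measure_display)
    (T1 : measurableType d1) (T2 : measurableType d2)
    (P1 : probability T1 R) (P2 : probability T2 R) (f : T1 -> R) :
  P1.-integrable [set: T1] (EFin \o f) ->
  (P1 \x P2)%E.-integrable [set: T1 * T2] (EFin \o (fun z => f z.1)).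
Proof.
move=> /integrableP[/measurable_EFinP mf fi].
have mf1 : measurable_fun [set: T1 * T2] (fun z => f z.1).
  exact: (measurableT_comp mf measurable_fst).
apply/integrableP; split; first exact/measurable_EFinP.
rewrite fubini_tonelli1 //=; last first.
  exact/measurable_EFinP/measurableT_comp.
rewrite /fubini_F /=; under eq_integral do rewrite integral_cst //= probability_setT mule1.
exact: fi.
Qed.

Lemma integrable_snd (R : realType) (d1 d2 : measure_display)
    (T1 : measurableType d1) (T2 : measurableType d2)
    (P1 : probability T1 R) (P2 : probability T2 R) (f : T2 -> R) :
  P2.-integrable [set: T2] (EFin \o f) ->
  (P1 \x P2)%E.-integrable [set: T1 * T2] (EFin \o (fun z => f z.2)).
Proof.
move=> /integrableP[/measurable_EFinP mf fi].
have mf2 : measurable_fun [set: T1 * T2] (fun z => f z.2).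
  exact: (measurableT_comp mf measurable_snd).
apply/integrableP; split; first exact/measurable_EFinP.
rewrite fubini_tonelli1 //=; last first.
  exact/measurable_EFinP/measurableT_comp.
rewrite /fubini_F /= integral_cst //= probability_setT mule1.
exact: fi.
Qed.

Lemma Rintegral_prod_bounded (R : realType) (d1 d2 : measure_display)
    (T1 : measurableType d1) (T2 : measurableType d2)
    (P1 : probability T1 R) (P2 : probability T2 R) (f : T1 * T2 -> R) (C : R) :
  measurable_fun [set: T1 * T2] f -> (forall z, `|f z| <= C) ->
  \int[(P1 \x P2)%E]_z f z = \int[P1]_x \int[P2]_y f (x, y).
Proof.
move=> mf fC; congr fine.
rewrite -integral12_prod_meas1; last exact: (@bounded_integrable _ _ _ (P1 \x P2)%E _ C).
apply: eq_integral => x _; rewrite /fubini_F fineK //.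
apply: integrable_fin_num => //; apply: (@bounded_integrable _ _ _ P2 _ C) => //.
exact: measurableT_comp.
Qed.

(** Coordinates are added one at a time by products with [normal_prob 0 1]. Beyond second moments
    only the cosine transform is recorded, as the laws of all linear forms follow from it. *)
Lemma standard_gaussian (R : realType) (n : nat) :
  exists (disp : measure_display) (T : measurableType disp)
    (Q : probability T R) (N : T -> 'rV[R]_n),
    [/\ random_vector N,
        forall i, Q.-integrable [set: T] (EFin \o (fun w => N w 0 i ^+ 2)) &
        forall (u : 'rV[R]_n) b, \int[Q]_w cos (\sum_i u 0 i * N w 0 i + b) =
          expR (- (\sum_i u 0 i ^+ 2 / 2)) * cos b].
Proof.
elim: n => [|n [disp [T [Q [N [mN iN cosN]]]]]].
  exists _, (measurableTypeR R), (\d_(0 : measurableTypeR R)), (fun=> 0); split => [i|i|u b]; [by case: i..|].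
  under eq_Rintegral do rewrite big_ord0.
  by rewrite Rintegral_probability_cst big_ord0 add0r oppr0 expR0 mul1r.
pose N' (z : T * measurableTypeR R) : 'rV[R]_n.+1 :=
  \row_i (if unlift ord0 i is Some j then N z.1 0 j else z.2).
have N'0 z : N' z 0 ord0 = z.2 by rewrite mxE unlift_none.
have N'S z j : N' z 0 (lift ord0 j) = N z.1 0 j by rewrite mxE liftK.
have mN' : random_vector N'.
  move=> i; case: (unliftP ord0 i) => [j|] ->.
    by under eq_fun do rewrite N'S; exact: (measurableT_comp (mN j) measurable_fst).
  by under eq_fun do rewrite N'0; exact: measurable_snd.
exists _, (T * measurableTypeR R)%type, (Q \x normal_prob 0 1)%E, N'; split => //.
  move=> i; case: (unliftP ord0 i) => [j|] ->.
    rewrite (_ : (fun z => _) = fun z => N z.1 0 j ^+ 2); last first.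
      by apply/funext => z; rewrite N'S.
    exact: (@integrable_fst _ _ _ _ _ Q (normal_prob 0 1) (fun w => N w 0 j ^+ 2)).
  rewrite (_ : (fun z => _) = fun z : T * measurableTypeR R => z.2 ^+ 2); last first.
    by apply/funext => z; rewrite N'0.
  apply: (@integrable_snd _ _ _ _ _ Q (normal_prob 0 1) (fun x => x ^+ 2)).
  apply: (@integrable_normal_prob R 1 (fun x => x ^+ 2) 1 (oner_neq0 _)).
    exact: exprn_measurable.
  by move=> x; rewrite mul1r ger0_norm ?sqr_ge0 // lerDr.
move=> u b.
rewrite (@Rintegral_prod_bounded _ _ _ _ _ _ _ _ 1); last 2 first.
- apply: measurable_cos_comp; apply: measurable_funD => //.
  exact: measurable_linear_form.
- by move=> z; exact: norm_cos_le1.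
pose v : 'rV[R]_n := \row_j u 0 (lift ord0 j).
(* For a fixed [w] the earlier coordinates only shift the phase, so the one-dimensional formula
   applies to the new one. *)
have inner w : \int[normal_prob 0 1]_x cos (\sum_i u 0 i * N' (w, x) 0 i + b) =
    expR (- (u 0 ord0 ^+ 2 / 2)) * cos (\sum_j v 0 j * N w 0 j + b).
  rewrite -[u 0 ord0 ^+ 2]mul1r -[X in X * u 0 ord0 ^+ 2](expr1n R 2) -normal_prob_cos ?oner_neq0 //.
  apply: eq_Rintegral => x _; rewrite big_ord_recl N'0 -addrA; congr (cos (_ + (_ + _))).
  by apply: eq_bigr => j _; rewrite N'S mxE.
under eq_Rintegral do rewrite inner.
rewrite RintegralZl //; last first.
  apply: (@bounded_integrable _ _ _ _ _ 1); last by move=> w; exact: norm_cos_le1.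
  apply: measurable_cos_comp; apply: measurable_funD => //.
  exact: measurable_linear_form.
rewrite cosN mulrA -expRD big_ord_recl opprD; congr (expR (_ - _) * _).
by apply: eq_bigr => j _; rewrite mxE.
Qed.

Lemma expectation_Rintegral (R : realType) (disp : measure_display)
    (T : measurableType disp) (Pr : probability T R) (X : T -> R) :
  Pr.-integrable [set: T] (EFin \o X) -> ('E_Pr[X] = (\int[Pr]_w X w)%:E)%E.
Proof.
by move=> iX; rewrite unlock /Rintegral fineK //; exact: integrable_fin_num.
Qed.

Lemma integrable_sqrD (R : realType) (disp : measure_display)
    (T : measurableType disp) (Pr : probability T R) (X Y : T -> R) :
  measurable_fun [set: T] X -> measurable_fun [set: T] Y ->
  Pr.-integrable [set: T] (EFin \o (fun w => X w ^+ 2)) ->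
  Pr.-integrable [set: T] (EFin \o (fun w => Y w ^+ 2)) ->
  Pr.-integrable [set: T] (EFin \o (fun w => (X w + Y w) ^+ 2)).
Proof.
move=> mX mY iX iY.
apply: (@le_integrable _ _ R Pr [set: T] measurableT
  (EFin \o (fun w => (X w + Y w) ^+ 2))
  (fun w => (2%:E * (X w ^+ 2)%:E + 2%:E * (Y w ^+ 2)%:E)%E)) => //.
- by apply/measurable_EFinP; apply: measurable_funX; exact: measurable_funD.
- move=> w _ /=; rewrite lee_fin !ger0_norm ?sqr_ge0 //.
    by have := sqr_ge0 (X w - Y w); lra.
  by have := sqr_ge0 (X w); have := sqr_ge0 (Y w); lra.
- exact: (integrableD measurableT (integrableZl measurableT 2 iX)
    (integrableZl measurableT 2 iY)).
Qed.

Lemma integrable_mul_sqr (R : realType) (disp : measure_display)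
    (T : measurableType disp) (Pr : probability T R) (X Y : T -> R) :
  measurable_fun [set: T] X -> measurable_fun [set: T] Y ->
  Pr.-integrable [set: T] (EFin \o (fun w => X w ^+ 2)) ->
  Pr.-integrable [set: T] (EFin \o (fun w => Y w ^+ 2)) ->
  Pr.-integrable [set: T] (EFin \o (fun w => X w * Y w)).
Proof.
move=> mX mY iX iY.
apply: (@le_integrable _ _ R Pr [set: T] measurableT
  (EFin \o (fun w => X w * Y w))
  (fun w => ((X w ^+ 2)%:E + (Y w ^+ 2)%:E)%E)) => //.
- by apply/measurable_EFinP; exact: measurable_funM.
- move=> w _ /=; rewrite lee_fin [leRHS]ger0_norm ?addr_ge0 ?sqr_ge0 //.
  by rewrite ler_norml; apply/andP; split;
    have := sqr_ge0 (X w - Y w); have := sqr_ge0 (X w + Y w); nra.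
- exact: (integrableD measurableT iX iY).
Qed.

Lemma integrable_sqr_linear_form (R : realType) (disp : measure_display)
    (T : measurableType disp) (Pr : probability T R) (n : nat)
    (Z : T -> 'rV[R]_n) (u : 'rV[R]_n) : random_vector Z ->
  (forall i, Pr.-integrable [set: T] (EFin \o (fun w => Z w 0 i ^+ 2))) ->
  Pr.-integrable [set: T] (EFin \o (fun w => (\sum_i u 0 i * Z w 0 i) ^+ 2)).
Proof.
move=> mZ iZ.
suff : forall s : seq 'I_n, Pr.-integrable [set: T]
    (EFin \o (fun w => (\sum_(i <- s) u 0 i * Z w 0 i) ^+ 2)) by [].
elim=> [|i s IH].
  rewrite (_ : (fun w => _) = cst 0); last first.
    by apply/funext => w; rewrite big_nil expr0n.
  by apply: (@bounded_integrable _ _ _ _ _ 0) => // w; rewrite normr0.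
rewrite (_ : (fun w => _) = fun w => (u 0 i * Z w 0 i + \sum_(j <- s) u 0 j * Z w 0 j) ^+ 2);
  last by apply/funext => w; rewrite big_cons.
apply: integrable_sqrD => //; first exact: measurable_funM.
  by apply: measurable_sum => j; exact: measurable_funM.
rewrite (_ : (fun w => _) = fun w => u 0 i ^+ 2 * Z w 0 i ^+ 2); last first.
  by apply/funext => w; rewrite exprMn.
exact: (integrableZl measurableT _ (iZ i)).
Qed.

Lemma integrable_square_norm (R : realType) (disp : measure_display)
    (T : measurableType disp) (Pr : probability T R) (n : nat) (Z : T -> 'rV[R]_n) :
  (forall i, Pr.-integrable [set: T] (EFin \o (fun w => Z w 0 i ^+ 2))) ->
  Pr.-integrable [set: T] (EFin \o (fun w => square_norm (Z w))).
Proof.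
move=> iZ; rewrite (_ : EFin \o _ = fun w => (\sum_i (Z w 0 i ^+ 2)%:E)%E).
  by apply: integrable_sum => // i _; exact: iZ.
by apply/funext => w; rewrite /= sumEFin.
Qed.

(** With [Y = N B], a linear form in [Y] is one in [N], so its cosine transform is that of a centred
    normal law, which identifies its law. *)
Lemma gaussian_linear_image (R : realType) (m n : nat) (B : 'M[R]_(m, n)) :
  exists (disp : measure_display) (T : measurableType disp)
    (Q : probability T R) (Y : T -> 'rV[R]_n),
    [/\ multivariate_normal Q Y 0 (B^T *m B),
        Q.-integrable [set: T] (EFin \o (fun w => square_norm (Y w))) &
        forall (u : 'rV[R]_n) b, \int[Q]_w cos (\sum_i u 0 i * Y w 0 i + b) =
          expR (- (\sum_k (\sum_i u 0 i * B k i) ^+ 2 / 2)) * cos b].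
Proof.
have [disp [T [Q [N [mN iN cosN]]]]] := standard_gaussian R m.
pose Y w := N w *m B; exists disp, T, Q, Y.
pose th (u : 'rV[R]_n) : 'rV[R]_m := \row_k \sum_i u 0 i * B k i.
have YE (u : 'rV[R]_n) w : \sum_i u 0 i * Y w 0 i = \sum_k th u 0 k * N w 0 k.
  under eq_bigr do rewrite mxE mulr_sumr.
  rewrite exchange_big; apply: eq_bigr => k _; rewrite mxE mulr_suml.
  by apply: eq_bigr => i _; ring.
have mY : random_vector Y.
  move=> i; rewrite (_ : (fun w => _) = fun w => \sum_k (\row_k B k i) 0 k * N w 0 k).
    exact: measurable_linear_form.
  by apply/funext => w; rewrite mxE; apply: eq_bigr => k _; rewrite mxE mulrC.
clearbody Y.
have cosY (u : 'rV[R]_n) b : \int[Q]_w cos (\sum_i u 0 i * Y w 0 i + b) =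
    expR (- (\sum_k (\sum_i u 0 i * B k i) ^+ 2 / 2)) * cos b.
  under eq_Rintegral do rewrite YE.
  rewrite cosN; congr (expR (- _) * _).
  by apply: eq_bigr => k _; rewrite mxE.
have mX (u : 'rV[R]_n) := measurable_linear_form u mY.
have iX (u : 'rV[R]_n) : Q.-integrable [set: T] (EFin \o (fun w => (\sum_i u 0 i * Y w 0 i) ^+ 2)).
  rewrite (_ : (fun w => _) = fun w => (\sum_k th u 0 k * N w 0 k) ^+ 2).
    exact: integrable_sqr_linear_form.
  by apply/funext => w; rewrite YE.
(* The variance of the linear form along [u]; it may vanish, a case that [normal_law] includes. *)
pose q (u : 'rV[R]_n) := \sum_k (\sum_i u 0 i * B k i) ^+ 2.
have q0 u : 0 <= q u by rewrite sumr_ge0 // => k _; exact: sqr_ge0.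
have cosX (u : 'rV[R]_n) t b : \int[Q]_w cos (t * (\sum_i u 0 i * Y w 0 i) + b) =
    expR (- (Num.sqrt (q u) ^+ 2 * t ^+ 2 / 2)) * cos b.
  have tE w : t * (\sum_i u 0 i * Y w 0 i) = \sum_i (t *: u) 0 i * Y w 0 i.
    by rewrite mulr_sumr; apply: eq_bigr => i _; rewrite mxE mulrA.
  under eq_Rintegral do rewrite tE.
  rewrite cosY sqr_sqrtr //; congr (expR (- _) * _).
  rewrite /q !mulr_suml; apply: eq_bigr => k _; congr (_ / _).
  rewrite mulrC -exprMn mulr_sumr; congr (_ ^+ 2).
  by apply: eq_bigr => i _; rewrite mxE mulrA.
have normalX (u : 'rV[R]_n) : [/\ forall C, measurable C ->
      Q ((fun w => \sum_i u 0 i * Y w 0 i) @^-1` C) = normal_law 0 (Num.sqrt (q u)) C,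
      \int[Q]_w (\sum_i u 0 i * Y w 0 i) = 0 &
      \int[Q]_w ((\sum_i u 0 i * Y w 0 i) ^+ 2) = q u].
  have [law mean sqr] := normal_law_of_cos (mX u) (iX u) (cosX u).
  by split => //; rewrite sqr sqr_sqrtr.
have YiE i w : Y w 0 i = \sum_j (delta_mx 0 i : 'rV[R]_n) 0 j * Y w 0 j.
  rewrite (bigD1 i) //= big1 => [|j ji]; first by rewrite mxE !eqxx mul1r addr0.
  by rewrite mxE (negPf ji) andbF mul0r.
have qi i : q (delta_mx 0 i) = \sum_k B k i ^+ 2.
  apply: eq_bigr => k _; congr (_ ^+ 2); rewrite (bigD1 i) //= big1 => [|j ji].
    by rewrite mxE !eqxx mul1r addr0.
  by rewrite mxE (negPf ji) andbF mul0r.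
have iYi i : Q.-integrable [set: T] (EFin \o (fun w => Y w 0 i ^+ 2)).
  by have := iX (delta_mx 0 i); under eq_fun do rewrite -YiE.
have EYi i : ('E_Q[fun w => Y w 0%R i] = 0)%E.
  rewrite expectation_Rintegral; last exact: (integrable_of_sqr (mY i) (iYi i)).
  by under eq_Rintegral do rewrite YiE; case: (normalX (delta_mx 0 i)) => _ -> _.
split => //; last exact: integrable_square_norm.
split.
- split => // u; exists 0, (Num.sqrt (q u)); split; first exact: sqrtr_ge0.
  by move=> C mC; case: (normalX u) => + _ _; apply.
- by move=> i; rewrite EYi mxE.
move=> i j; rewrite unlock !EYi /=.
have iYij := integrable_mul_sqr (mY i) (mY j) (iYi i) (iYi j).
rewrite (_ : (_ * _)%R = fun w => Y w 0 i * Y w 0 j); last first.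
  by apply/funext => w; rewrite ?fine0 -[LHS]/((Y w 0 i - 0) * (Y w 0 j - 0)) !subr0.
rewrite expectation_Rintegral //; congr EFin.
(* Polarization: the mixed moment is read off the second moment along [e_i + e_j]. *)
have [_ _ Eij] := normalX (delta_mx 0 i + delta_mx 0 j).
have [_ _ Ei] := normalX (delta_mx 0 i); have [_ _ Ej] := normalX (delta_mx 0 j).
have uE w : \sum_k (delta_mx 0 i + delta_mx 0 j : 'rV[R]_n) 0 k * Y w 0 k = Y w 0 i + Y w 0 j.
  rewrite (YiE i w) (YiE j w) -big_split; apply: eq_bigr => k _.
  by rewrite mxE mulrDl.
have qij : q (delta_mx 0 i + delta_mx 0 j) =
    \sum_k B k i ^+ 2 + \sum_k B k j ^+ 2 + 2 * (B^T *m B) i j.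
  rewrite mxE mulr_sumr -!big_split /=; apply: eq_bigr => k _.
  rewrite mxE (_ : \sum__ _ = B k i + B k j); first by ring.
  under eq_bigr do rewrite mxE mulrDl.
  rewrite big_split /= (bigD1 i) //= big1 => [|l li]; last first.
    by rewrite mxE (negPf li) andbF mul0r.
  rewrite (bigD1 j) //= big1 => [|l lj]; last by rewrite mxE (negPf lj) andbF mul0r.
  by rewrite !mxE !eqxx !mul1r !addr0.
have : \int[Q]_w ((Y w 0 i + Y w 0 j) ^+ 2) =
    \int[Q]_w (Y w 0 i ^+ 2) + \int[Q]_w (Y w 0 j ^+ 2) + 2 * \int[Q]_w (Y w 0 i * Y w 0 j).
  rewrite -RintegralD // -RintegralZl // -RintegralD //.
  - by apply: eq_Rintegral => w _; ring.
  - exact: (integrableD measurableT (iYi i) (iYi j)).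
  - exact: (integrableZl measurableT 2 iYij).
have -> : \int[Q]_w ((Y w 0 i + Y w 0 j) ^+ 2) = q (delta_mx 0 i + delta_mx 0 j).
  by rewrite -Eij; under [RHS]eq_Rintegral do rewrite uE.
have -> : \int[Q]_w (Y w 0 i ^+ 2) = q (delta_mx 0 i).
  by rewrite -Ei; under [RHS]eq_Rintegral do rewrite -YiE.
have -> : \int[Q]_w (Y w 0 j ^+ 2) = q (delta_mx 0 j).
  by rewrite -Ej; under [RHS]eq_Rintegral do rewrite -YiE.
by rewrite qij !qi; lra.
Qed.

(** * The central limit theorem for additive functionals *)

Lemma chain_path_finite (R : realType) (disp : measure_display)
    (T : measurableType disp) (d : nat) (X : nat -> T -> 'I_d)
    (mX : forall n i, measurable [set w | X n w = i]) (K : nat)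
    (F : (nat -> 'I_d) -> R)
    (F_ext : forall x y, (forall k, (k <= K)%N -> x k = y k) -> F x = F y) :
  exists (Y : T -> {ffun 'I_K.+1 -> 'I_d}) (f : {ffun 'I_K.+1 -> 'I_d} -> R),
    (forall y, measurable [set w | Y w = y]) /\ forall w, F (X^~ w) = f (Y w).
Proof.
exists (fun w => [ffun k : 'I_K.+1 => X k w]), (fun y => F (fun n => y (inord n))).
split=> [y|w]; last first.
  by apply: F_ext => k kK; rewrite ffunE inordK.
have -> : [set w | [ffun k : 'I_K.+1 => X k w] = y] =
    \bigcap_(k in [set k | (k <= K)%N]) [set w | X k w = y (inord k)].
  apply/seteqP; split=> w /= => [<- k kK|wy]; first by rewrite /= ffunE inordK.
  by apply/ffunP => k; rewrite ffunE (wy k (leq_ord k)) inord_val.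
by apply: bigcap_measurable => [|k _]; [exists 0%N|exact: mX].
Qed.

(** Reduction to one direction [u]: the states do not depend on the increments, so a linear form of
    the centred sum is itself a real additive functional of the same chain. *)
Lemma walk_run_linear (E J : Type) (R : realType) (n : nat) (init : J -> E)
    (upd : E -> J -> E) (z : E -> J -> 'rV[R]_n) (u g : 'rV[R]_n)
    (x : nat -> J) (K : nat) :
  walk_run init upd (fun e j => \sum_i u 0 i * (z e j 0 i - g 0 i)) x K =
  ((walk_run init upd z x K).1,
   \sum_i u 0 i * ((walk_run init upd z x K).2 0 i - K%:R * g 0 i)).
Proof.
elim: K => [|K IH] /=.
  by congr pair; rewrite big1 // => i _; rewrite mxE mul0r subrr mulr0.
rewrite IH /=; congr pair; rewrite -big_split /=; apply: eq_bigr => i _.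
by rewrite mxE -natr1; ring.
Qed.

Lemma symmetric_psd_gram (R : realType) (m n : nat) (B : 'M[R]_(m, n)) :
  symmetric_psd (B^T *m B).
Proof.
split; first by rewrite trmx_mul trmxK.
move=> v; have -> : v *m (B^T *m B) *m v^T = (v *m B^T) *m (v *m B^T)^T.
  by rewrite trmx_mul trmxK !mulmxA.
rewrite mxE sumr_ge0 // => k _; rewrite [(_^T) _ _]mxE -expr2.
exact: sqr_ge0.
Qed.

Lemma markov_additive_clt (R : realType) (d : nat) (P : 'M[R]_d)
    (P_stoch : stochastic P) (disp : measure_display) (T : measurableType disp)
    (Pr : probability T R) (X : nat -> T -> 'I_d) (X_chain : markov_chain Pr P X)
    (E : finType) (init : 'I_d -> E) (upd : E -> 'I_d -> E) (pos : E -> 'I_d)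
    (pos_init : forall i, pos (init i) = i)
    (pos_upd : forall e j, pos (upd e j) = j)
    (e0 : E)
    (reach : forall e, connect (transition_rel (fun e j => P (pos e) j) upd) e e0)
    (n : nat) (z : E -> 'I_d -> 'rV[R]_n) :
  exists (g : 'rV[R]_n) (M : 'M[R]_n), symmetric_psd M /\
    exists (disp' : measure_display) (T' : measurableType disp')
        (Q : probability T' R) (Y : T' -> 'rV[R]_n),
      multivariate_normal Q Y 0 M /\
      cvg_in_distribution Pr
        (fun K w => Num.sqrt K%:R *:
           (K%:R^-1 *: (walk_run init upd z (X^~ w) K).2 - g)) Q Y.
Proof.
pose p e j := P (pos e) j.
have p0 e j : 0 <= p e j by exact: P_stoch.1.
have p1 e : \sum_j p e j = 1 by exact: P_stoch.2.
have [w [w0 poisson]] := poisson_equation p0 p1 reach.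
(* As [w] is the invariant law, this is the stationary mean of one increment. *)
pose g : 'rV[R]_n := \row_i \sum_e w e * \sum_j p e j * z e j 0 i.
have /choice[h hE] (i : 'I_n) : exists h : E -> R, forall e,
    \sum_j p e j * z e j 0 i = h e - markov_op p upd h e + g 0 i.
  have [h hE] := poisson (fun e => \sum_j p e j * z e j 0 i).
  by exists h => e; rewrite hE mxE.
pose D e j i := z e j 0 i - g 0 i + h i (upd e j) - h i e.
have D0 e i : \sum_j p e j * D e j i = 0.
  have -> : \sum_j p e j * D e j i = \sum_j p e j * z e j 0 i -
      g 0 i * \sum_j p e j + markov_op p upd (h i) e - h i e * \sum_j p e j.
    rewrite /markov_op !mulr_sumr -!sumrB -big_split -sumrB /=.
    by apply: eq_bigr => j _; rewrite /D; ring.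
  by rewrite hE p1; ring.
(* Rows are indexed by labelled transitions and weighted by the square root of their stationary
   probability, so [B^T *m B] is the stationary covariance of the martingale increments [D].
   Nonnegativity of [w] makes the roots meaningful. *)
pose B : 'M[R]_(#|{: E * 'I_d}|, n) := \matrix_(k, i)
  (Num.sqrt (w (enum_val k).1 * p (enum_val k).1 (enum_val k).2) *
   D (enum_val k).1 (enum_val k).2 i).
have [disp' [T' [Q [Y [normY iY cosY]]]]] := gaussian_linear_image B.
exists g, (B^T *m B); split; first exact: symmetric_psd_gram.
exists disp', T', Q, Y; split=> //.
pose S K t := (walk_run init upd z (X^~ t) K).2.
pose Z K t := Num.sqrt K%:R *: (K%:R^-1 *: S K t - g).
(* The Poisson equation is linear, so one corrector per coordinate yields the corrector [ht u] of
   every direction. *)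
pose zt (u : 'rV[R]_n) e j := \sum_i u 0 i * (z e j 0 i - g 0 i).
pose ht (u : 'rV[R]_n) e := \sum_i u 0 i * h i e.
have DtE (u : 'rV[R]_n) e j : zt u e j + ht u (upd e j) - ht u e = \sum_i u 0 i * D e j i.
  rewrite /zt /ht -big_split -sumrB /=; apply: eq_bigr => i _.
  by rewrite /D; ring.
have Dt0 (u : 'rV[R]_n) e : \sum_j p e j * (zt u e j + ht u (upd e j) - ht u e) = 0.
  under eq_bigr do rewrite DtE mulr_sumr.
  rewrite exchange_big big1 //= => i _.
  by under eq_bigr do rewrite mulrCA; rewrite -mulr_sumr D0 mulr0.
have ZE (u : 'rV[R]_n) K t : (0 < K)%N ->
    \sum_i u 0 i * Z K t 0 i =
    (Num.sqrt K%:R)^-1 * (walk_run init upd (zt u) (X^~ t) K).2.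
  move=> K0; rewrite walk_run_linear /= mulr_sumr; apply: eq_bigr => i _.
  rewrite /Z /S !mxE.
  have sK : Num.sqrt K%:R != 0 :> R by rewrite gt_eqF // sqrtr_gt0 ltr0n.
  have KE : K%:R = Num.sqrt K%:R ^+ 2 :> R by rewrite sqr_sqrtr.
  rewrite [X in _ * (X^-1 * _ - _)]KE [X in _ - X * _]KE.
  by field.
have [mX _] := X_chain.
have finite_path K (F : (nat -> 'I_d) -> R) :
    (forall x y, (forall k, (k <= K)%N -> x k = y k) -> F x = F y) ->
    measurable_fun [set: T] (fun t => F (X^~ t)) /\
    Pr.-integrable [set: T] (EFin \o (fun t => F (X^~ t))).
  move=> F_ext; have [Y' [f [mY' fY']]] := chain_path_finite mX F_ext.
  rewrite (_ : (fun t => F _) = fun t => f (Y' t)); last by apply/funext.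
  by split; [exact: measurable_finite_valued|exact: integrable_finite_valued].
have mZ K : random_vector (Z K).
  move=> i; apply: (finite_path K (fun x =>
    (Num.sqrt K%:R *: (K%:R^-1 *: (walk_run init upd z x K).2 - g)) 0 i) _).1.
  by move=> x y xy; rewrite (walk_run_ext _ _ _ xy).
have iZ K i : Pr.-integrable [set: T] (EFin \o (fun t => Z K t 0 i ^+ 2)).
  apply: (finite_path K (fun x =>
    (Num.sqrt K%:R *: (K%:R^-1 *: (walk_run init upd z x K).2 - g)) 0 i ^+ 2) _).2.
  by move=> x y xy; rewrite (walk_run_ext _ _ _ xy).
have iter_int (K : nat) (u : 'rV[R]_n) (G : E -> R -> R) :
    Pr.-integrable [set: T] (EFin \o
      (fun t => iter K (walk_op p upd (zt u)) G (init (X 0%N t)) 0)).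
  exact: (integrable_finite_valued Pr (mX 0%N)
    (fun i => iter K (walk_op p upd (zt u)) G (init i) 0)).
have icst (c : R) : Pr.-integrable [set: T] (EFin \o (fun=> c)).
  by apply: (@bounded_integrable _ _ _ _ _ `|c|).
have /choice[C CE] (i : 'I_n) : exists C : R, forall K, \int[Pr]_t (Z K t 0 i ^+ 2) <= C.
  pose u : 'rV[R]_n := delta_mx 0 i.
  have [C CE] := walk_op_sqr_le p0 p1 (Dt0 u).
  (* The maximum with 0 handles [K = 0], where the factor [Num.sqrt 0] makes [Z] vanish. *)
  exists (Num.max C 0) => -[|K].
    under eq_Rintegral do rewrite /Z sqrtr0 scale0r mxE expr0n /=.
    by rewrite Rintegral_probability_cst le_max lexx orbT.
  have sK : 0 < Num.sqrt K.+1%:R :> R by rewrite sqrtr_gt0 ltr0n.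
  have ZiE t : Z K.+1 t 0 i ^+ 2 = K.+1%:R^-1 *
      (let ev := walk_run init upd (zt u) (X^~ t) K.+1 in
       (fun (_ : E) (v : R) => v ^+ 2) ev.1 ev.2).
    have -> : Z K.+1 t 0 i = \sum_k u 0 k * Z K.+1 t 0 k.
      rewrite (bigD1 i) //= big1 => [|k ki]; first by rewrite [u _ _]mxE !eqxx mul1r addr0.
      by rewrite [u _ _]mxE (negPf ki) andbF mul0r.
    by rewrite ZE // exprMn exprVn sqr_sqrtr.
  rewrite (eq_Rintegral _ (fun t _ => ZiE t)) RintegralZl //; last first.
    apply: (finite_path K.+1 (fun x => let ev := walk_run init upd (zt u) x K.+1 in
       (fun (_ : E) (v : R) => v ^+ 2) ev.1 ev.2) _).2.
    by move=> x y xy; rewrite (walk_run_ext _ _ _ xy).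
  rewrite (Rintegral_walk_run X_chain pos_init pos_upd (zt u) K.+1 (fun _ v => v ^+ 2)).
  rewrite mulrC ler_pdivrMr ?ltr0n //.
  apply: (@le_trans _ _ (C * K.+1%:R)); last by rewrite ler_wpM2r // le_max lexx.
  rewrite -[leRHS](Rintegral_probability_cst Pr).
  apply: (le_Rintegral measurableT (iter_int _ u _) (icst _)) => t _.
  exact: CE.
have ZC K : \int[Pr]_t square_norm (Z K t) <= \sum_i C i.
  have -> : \int[Pr]_t square_norm (Z K t) = \sum_i \int[Pr]_t (Z K t 0 i ^+ 2).
    rewrite /Rintegral /square_norm.
    under eq_integral do rewrite -sumEFin.
    rewrite (integral_sum measurableT (fun i => iZ K i)) -sum_fine // => i _.
    by apply: integrable_fin_num => //; exact: iZ.
  by apply: ler_sum => i _.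
have cosZ (u : 'rV[R]_n) b :
    \int[Pr]_t cos (\sum_i u 0 i * Z K t 0 i + b) @[K --> \oo] -->
    \int[Q]_t cos (\sum_i u 0 i * Y t 0 i + b).
  (* The conditional variance is quadratic in [u], so its corrector is found anew for each
     direction. *)
  pose q e := \sum_j p e j * (zt u e j + ht u (upd e j) - ht u e) ^+ 2.
  have [gc gcE] := poisson q; set sig2 := \sum_e _ in gcE.
  have sig20 : 0 <= sig2.
    apply: sumr_ge0 => e _; rewrite mulr_ge0 // sumr_ge0 // => j _.
    by rewrite mulr_ge0 // sqr_ge0.
  have gE e : q e - sig2 = gc e - markov_op p upd gc e.
    by rewrite gcE; ring.
  have [C' C'E] := walk_op_cos_cvg p0 p1 (Dt0 u) sig20 gE.
  (* Both variances are the stationary mean of the squared increment along [u]: a sum over the rows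
     of [B] on one side, the [w]-average of [q] on the other. *)
  have -> : \int[Q]_t cos (\sum_i u 0 i * Y t 0 i + b) = expR (- (sig2 / 2)) * cos b.
    rewrite cosY; congr (expR (- _) * _).
    rewrite -mulr_suml; congr (_ / _).
    pose F (ej : E * 'I_d) := w ej.1 * (p ej.1 ej.2 *
      (zt u ej.1 ej.2 + ht u (upd ej.1 ej.2) - ht u ej.1) ^+ 2).
    transitivity (\sum_(k < #|{: E * 'I_d}|) F (enum_val k)).
      apply: eq_bigr => k _; rewrite /F DtE.
      rewrite (_ : \sum_i u 0 i * B k i = Num.sqrt (w (enum_val k).1 *
        p (enum_val k).1 (enum_val k).2) * \sum_i u 0 i * D (enum_val k).1 (enum_val k).2 i).
        by rewrite exprMn sqr_sqrtr ?mulr_ge0 // mulrA.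
      by rewrite mulr_sumr; apply: eq_bigr => i _; rewrite mxE mulrCA.
    rewrite -(big_enum_val F) /= /sig2 /q.
    under [RHS]eq_bigr do rewrite mulr_sumr.
    by rewrite pair_bigA; apply: eq_bigl.
  apply/cvgrPdist_le => e e_gt0.
  have C'0 : 0 < `|C'| + 1 by rewrite ltr_wpDl.
  (* From this index on [Num.sqrt K%:R] exceeds [(|C'| + 1) / e]; the added 1 keeps the constant
     positive. *)
  exists (Num.truncn (((`|C'| + 1) / e) ^+ 2)).+1 => // K /= KN.
  have K0 : (0 < K)%N by exact: leq_trans KN.
  have sK : 0 < Num.sqrt K%:R :> R by rewrite sqrtr_gt0 ltr0n.
  have Ce : (`|C'| + 1) * (Num.sqrt K%:R)^-1 <= e.
    rewrite ler_pdivrMr // mulrC -ler_pdivrMr //.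
    rewrite -[leLHS]ger0_norm ?divr_ge0 ?(ltW C'0) ?(ltW e_gt0) // -sqrtr_sqr ler_sqrt ?ler0n //.
    by apply: ltW; apply: lt_le_trans (truncnS_gt _) _; rewrite ler_nat.
  have E1 : \int[Pr]_t cos (\sum_i u 0 i * Z K t 0 i + b) =
      \int[Pr]_t iter K (walk_op p upd (zt u))
        (fun _ v => cos ((Num.sqrt K%:R)^-1 * v + b)) (init (X 0%N t)) 0.
    rewrite -(Rintegral_walk_run X_chain pos_init pos_upd (zt u) K
      (fun _ v => cos ((Num.sqrt K%:R)^-1 * v + b))).
    by apply: eq_Rintegral => t _; rewrite ZE.
  rewrite E1 -[X in X - _](Rintegral_probability_cst Pr).
  rewrite -RintegralB //.
  have id_ : Pr.-integrable [set: T] (EFin \o (fun t => expR (- (sig2 / 2)) * cos b -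
      iter K (walk_op p upd (zt u)) (fun _ v => cos ((Num.sqrt K%:R)^-1 * v + b))
        (init (X 0%N t)) 0)).
    exact: (integrableB measurableT (icst _) (iter_int K u _)).
  apply: le_trans (le_normr_Rintegral _ id_) _ => //.
  rewrite -[leRHS](Rintegral_probability_cst Pr).
  apply: (le_Rintegral measurableT (integrable_norm id_) (icst _)) => t _.
  rewrite /= distrC; apply: le_trans (C'E K b _ K0) _.
  apply: le_trans Ce; rewrite ler_wpM2r ?invr_ge0 ?(ltW sK) //.
  by have := ler_norm C'; lra.
have mY : random_vector Y by case: normY => -[].
split=> // f fcont [C' fC'].
have mf K := measurable_bounded_continuous (mZ K) fcont fC'.
have mfY := measurable_bounded_continuous mY fcont fC'.
rewrite expectation_Rintegral; last exact: (bounded_integrable Q mfY (C := C')).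
under eq_fun do rewrite (expectation_Rintegral (bounded_integrable Pr (mf _) (C := C') _)) //.
apply: cvg_EFin; first exact: nearW.
exact: (cvg_bounded_continuous mZ mY (fun K => integrable_square_norm (iZ K)) iY ZC cosZ fcont fC').
Qed.

(** * The pattern of nonzero entries of Lambda *)

(* The pattern of nonzero entries of Lambda, attached to the current state of
   the chain; its evolution does not depend on the values of Lambda. *)
Definition pattern_init (d : nat) (i : 'I_d) : 'I_d * 'M[bool]_d :=
  (i, const_mx false).

(** The status after the scaling and before column [j] is cleared: this is what the count reads,
    whereas [pattern_step] keeps it only outside column [j]. *)
Definition pattern_live (R : realType) (d : nat) (A : 'M[R]_d)
    (e : 'I_d * 'M[bool]_d) (j k l : 'I_d) : bool :=
  (A e.1 j != 0) && (e.2 k l || (k == e.1)).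

Definition pattern_step (R : realType) (d : nat) (A : 'M[R]_d)
    (e : 'I_d * 'M[bool]_d) (j : 'I_d) : 'I_d * 'M[bool]_d :=
  (j, \matrix_(k, l) ((l != j) && pattern_live A e j k l)).

Definition pattern_count (R : realType) (d : nat) (A : 'M[R]_d)
    (e : 'I_d * 'M[bool]_d) (j : 'I_d) : 'M[R]_d :=
  \matrix_(k, l) ((l == j) && pattern_live A e j k l)%:R.

(** No cancellation can occur in Lambda, whose entries are products of factors [A i j / P i j];
    hence an entry dies only through a zero factor or the clearing of its column. *)
Lemma uvn_run_pattern (R : realType) (d : nat) (A P : 'M[R]_d)
    (P_supp : forall i j, 0 < P i j <-> A i j != 0) (x : nat -> 'I_d) (K : nat) :
  let e := walk_run (@pattern_init d) (pattern_step A) (pattern_count A) x K in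
  [/\ e.1.1 = x K,
      forall k l, (uvn_Lambda (uvn_run A P x K) k l != 0) = e.1.2 k l &
      GammaK A P x K = e.2].
Proof.
elim: K => [|K [xK LK GK]] /=.
  split=> //; first by move=> k l; rewrite !mxE eqxx.
  by apply/matrixP => k l; rewrite !mxE.
set e := walk_run _ _ _ _ _ in xK LK GK *.
set st := uvn_run A P x K in LK GK *.
(* [P_supp] ensures that a nonzero [A] entry is divided by a positive number; division by 0 would
   return 0 and kill the entries. *)
have APE : (A (x K) (x K.+1) / P (x K) (x K.+1) != 0) = (A (x K) (x K.+1) != 0).
  have [->|A0] := eqVneq (A (x K) (x K.+1)) 0; first by rewrite mul0r eqxx.
  have /P_supp P0 := A0.
  by rewrite mulf_neq0 // invr_neq0 // gt_eqF.
have live k l : (A (x K) (x K.+1) / P (x K) (x K.+1) *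
    (if (k == x K) && (uvn_Lambda st k l == 0) then 1 else uvn_Lambda st k l) != 0) =
    pattern_live A e.1 (x K.+1) k l.
  rewrite mulf_eq0 negb_or APE /pattern_live xK -LK; congr (_ && _).
  case: (k == x K); case: (eqVneq (uvn_Lambda st k l) 0) => [E|L0] /=;
    by rewrite ?oner_neq0 ?E ?eqxx ?L0.
split=> //.
  move=> k l; rewrite !mxE; case: (l == x K.+1) => /=; first by rewrite eqxx.
  by rewrite live.
rewrite -GK; apply/matrixP => k l; rewrite !mxE live.
by case: ifP => _; rewrite ?addr0 // -natr1.
Qed.

(** * Reachability in the pattern chain *)

Definition positive_step (R : realType) (d : nat) (P : 'M[R]_d) : rel 'I_d :=
  fun i j => 0 < P i j.

Lemma irreducible_connect (R : realType) (d : nat) (P : 'M[R]_d) (i j : 'I_d) :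
  stochastic P -> irreducible P -> connect (positive_step P) i j.
Proof.
move=> [P0 _] /(_ i j)[n]; elim: n i => [|n IH] i.
  rewrite expr0 mxE; case: (eqVneq i j) => [-> _|_]; first exact: connect0.
  by rewrite ltxx.
have Pn0 m k l : 0 <= (P ^+ m) k l.
  elim: m k l => [|m IHm] k l; first by rewrite expr0 mxE; case: eqP.
  by rewrite exprS mxE sumr_ge0 // => h _; rewrite mulr_ge0.
rewrite exprS mxE lt_def => /andP[+ _].
rewrite psumr_neq0 => [|k _]; last by rewrite mulr_ge0.
move=> /hasP[k _ /= Pk].
have Pik : 0 < P i k.
  by rewrite lt_def P0 andbT; apply: contraTneq Pk => ->; rewrite mul0r ltxx.
apply: (connect_trans (connect1 (Pik : positive_step P i k))); apply: IH.
by rewrite lt_def Pn0 andbT; apply: contraTneq Pk => ->; rewrite mulr0 ltxx.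
Qed.

Lemma path_through (R : realType) (d : nat) (P : 'M[R]_d)
    (P_stoch : stochastic P) (P_irr : irreducible P) (i : 'I_d) (s : seq 'I_d) :
  exists2 t, path (positive_step P) i t & {subset s <= t}.
Proof.
elim: s i => [|l s IH] i; first by exists [::].
(* The sequence omits its starting point, so a first step is forced in order that [l] be visited at
   a positive time even when [l = i]. *)
have [k ik] : exists k, positive_step P i k.
  have : \sum_k P i k != 0 by rewrite P_stoch.2 oner_neq0.
  rewrite psumr_neq0 => [/hasP[k _ /= ik]|k _]; first by exists k.
  exact: P_stoch.1.
have /connectP[t kt lE] := irreducible_connect k l P_stoch P_irr.
have [t' lt' st'] := IH l.
exists (k :: t ++ t'); first by rewrite /= ik cat_path kt -lE.
move=> a; rewrite inE => /orP[/eqP ->|/st' at']; last by rewrite in_cons mem_cat at' !orbT.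
by rewrite lE -cat_cons mem_cat mem_last.
Qed.

Lemma connect_pattern (R : realType) (d : nat) (A P : 'M[R]_d)
    (e : 'I_d * 'M[bool]_d) (s : seq 'I_d) : path (positive_step P) e.1 s ->
  connect (transition_rel (fun e j => P e.1 j) (pattern_step A)) e
    (foldl (pattern_step A) e s).
Proof.
elim: s e => [|j s IH] e /=; first by rewrite connect0.
move=> /andP[ej js]; apply: (connect_trans (connect1 _) (IH (pattern_step A e j) js)).
by apply/existsP; exists j; rewrite eqxx andbT.
Qed.

Lemma foldl_pattern_fst (R : realType) (d : nat) (A : 'M[R]_d)
    (e : 'I_d * 'M[bool]_d) (s : seq 'I_d) :
  (foldl (pattern_step A) e s).1 = last e.1 s.
Proof. by elim: s e => [//|j s IH] e /=; rewrite IH. Qed.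

(* Moving to a state clears its column of the pattern, so a path visiting all
   states forgets the initial pattern. *)
Lemma foldl_pattern_agree (R : realType) (d : nat) (A : 'M[R]_d) (c : pred 'I_d)
    (i : 'I_d) (M M' : 'M[bool]_d) (s : seq 'I_d) :
  (forall k l, c l -> M k l = M' k l) ->
  forall k l, c l || (l \in s) ->
    (foldl (pattern_step A) (i, M) s).2 k l = (foldl (pattern_step A) (i, M') s).2 k l.
Proof.
elim: s c i M M' => [|j s IH] c i M M' MM' k l; first by rewrite orbF => /MM'.
(* [c] collects the columns known to agree; after the move to [j], column [j] is false in both
   patterns and joins it. *)
rewrite in_cons => cl /=; apply: (IH (fun l => c l || (l == j))); last by rewrite -orbA.
move=> k' l'; rewrite !mxE /pattern_live /=.
by case: (l' == j) => //=; rewrite orbF => cl'; rewrite MM'.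
Qed.

(** From any state the chain can move to [i0] and then follow a fixed tour of all states; the tour
    resets every column, so its endpoint does not depend on the pattern at its start. *)
Lemma pattern_reach (R : realType) (d : nat) (A P : 'M[R]_d)
    (P_stoch : stochastic P) (P_irr : irreducible P) (i0 : 'I_d) :
  exists e0, forall e,
    connect (transition_rel (fun e j => P e.1 j) (pattern_step A)) e e0.
Proof.
have [s0 i0s0 s0E] := path_through P_stoch P_irr i0 (enum 'I_d).
exists (foldl (pattern_step A) (pattern_init i0) s0) => -[i M].
have /connectP[s is_ i0E] := irreducible_connect i i0 P_stoch P_irr.
have h := connect_pattern A (e := (i, M)) is_.
apply: (connect_trans h); set e1 := foldl _ _ _.
have e1E : e1.1 = i0 by rewrite foldl_pattern_fst.
have : path (positive_step P) e1.1 s0 by rewrite e1E.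
move=> /(connect_pattern A); congr (connect _ _ _).
rewrite [e1]surjective_pairing e1E; apply/eqP; rewrite -pair_eqE /pair_eq /=.
rewrite !foldl_pattern_fst eqxx /=; apply/eqP/matrixP => k l.
apply: (@foldl_pattern_agree R d A pred0) => //=.
by apply: s0E; rewrite mem_enum.
Qed.

Theorem theorem4p1 (R : realType) (d : nat) (A P : 'M[R]_d)
  (A_unit : A \in unitmx)
  (rhoA : spectral_radius A < 1)
  (P_stoch : stochastic P)
  (P_supp : forall i j, 0 < P i j <-> A i j != 0)
  (P_irr : irreducible P)
  (P_aper : aperiodic P)
  (rhoH : spectral_radius (Hhat A P) < 1)
  (disp : measure_display) (T : measurableType disp) (Pr : probability T R)
  (X : nat -> T -> 'I_d)
  (X_chain : markov_chain Pr P X) :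
  exists (Gamma_s : 'M[R]_d) (M_s : 'M[R]_(d * d)),
    symmetric_psd M_s /\
    exists (disp' : measure_display) (T' : measurableType disp')
        (Q : probability T' R) (Y : T' -> 'rV[R]_(d * d)),
      multivariate_normal Q Y 0 M_s /\
      cvg_in_distribution Pr
        (fun K w => mxvec (Num.sqrt K%:R *:
           (K%:R^-1 *: GammaK A P (fun n => X n w) K - Gamma_s)))
        Q Y.
Proof.
(* A sample point is wanted only to exhibit a state of the chain, from which the tour defining [e0]
   starts. *)
have [t0 _] : [set: T] !=set0.
  apply/set0P/eqP => T0; have := probability_setT Pr.
  by rewrite T0 measure0 => /eqP; rewrite eq_sym onee_eq0.
have [e0 reach] := pattern_reach A P_stoch P_irr (X 0%N t0).
have [g [M [M_psd [disp' [T' [Q [Y [normY cvgY]]]]]]]] :=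
  @markov_additive_clt R d P P_stoch disp T Pr X X_chain _ (@pattern_init d)
    (pattern_step A) fst (fun=> erefl) (fun _ _ => erefl) e0 reach _
    (fun e j => mxvec (pattern_count A e j)).
exists (vec_mx g), M; split=> //; exists disp', T', Q, Y; split=> //.
set Z := (Z in cvg_in_distribution _ Z) in cvgY.
set Z' := (Z in cvg_in_distribution _ Z).
suff -> : Z' = Z by [].
rewrite /Z /Z' => {Z Z' cvgY}; apply/funext => K; apply/funext => w.
have [_ _ ->] := uvn_run_pattern P_supp (X^~ w) K.
rewrite !linearZ /= linearB linearZ /= vec_mxK; congr (_ *: (_ *: _ - _)).
(* [mxvec] is additive and the states ignore the increments, so flattening passes inside the
   walk. *)
elim: K => [|K IH] /=; first by rewrite linear0.
rewrite linearD -IH; congr (_ + mxvec (pattern_count A _ _)).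
by elim: (K) => [//|k IHk] /=; rewrite IHk.
Qed.
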